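(* Let $A$ be a unital $C^*$-algebra, let $G$ be a compact group, and let $\alpha$ be a strongly continuous action of $G$ on $A$ by $*$-automorphisms which is ergodic, i.e. the only elements $a\in A$ with $\alpha_x(a)=a$ for all $x\in G$ are those in $\mathbb C1$. Let $\ell$ be a continuous length function on $G$, and define $L(a)=\sup\{\|\alpha_x(a)-a\|/\ell(x): x\in G,\ x\neq e\}$ for $a\in A$ (value $+\infty$ allowed). Then the restriction of $L$ to the order-unit space $\{a\in A_{sa}: L(a)<\infty\}$ is a Lip-norm, i.e. $(\{a\in A_{sa}: L(a)<\infty\},L)$ is a compact quantum metric space.
   Context: A continuous length function on $G$ is a continuous $\ell:G\to\mathbb R^+$ with $\ell(xy)\le\ell(x)+\ell(y)$, $\ell(x^{-1})=\ell(x)$, and $\ell(x)=0$ iff $x=e$. $A_{sa}$ is the set of self-adjoint elements of $A$, an order-unit space with order unit $1$. For an order-unit space $A$ (a real space of self-adjoint operators containing the identity, with operator order and norm), its state space $S(A)$ is the set of positive linear functionals $\mu$ with $\mu(1)=1$, with the weak-$*$ topology. A Lip-norm on an order-unit space $A$ is a finite-valued seminorm $L$ with $L(1)=0$ such that the topology on $S(A)$ from the metric $\rho_L(\mu,\nu)=\sup\{|\mu(a)-\nu(a)|: L(a)\le 1\}$ coincides with the weak-$*$ topology. A compact quantum metric space is a pair $(A,L)$ with $L$ a Lip-norm on the order-unit space $A$. *)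

(* Defs.v *)
From HB Require Import structures.
From mathcomp Require Import all_boot all_order all_algebra.
From mathcomp Require Import all_classical all_reals all_analysis.
From mathcomp Require Import complex.
Set Implicit Arguments. Unset Strict Implicit. Unset Printing Implicit Defensive.
Import Order.TTheory GRing.Theory Num.Theory numFieldNormedType.Exports.
Local Open Scope classical_set_scope.
Local Open Scope ring_scope.
Local Open Scope complex_scope.

(* A is a complex Banach space (complete normed R[i]-module); mul, one, star
   give the unital Banach *-algebra structure satisfying the C*-identity.
   Norms of elements of A are valued in R[i] (they are real numbers). *)
Definition cstar_algebra (R : realType) (A : completeNormedModType R[i])
  (mul : A -> A -> A) (one : A) (star : A -> A) : Prop :=
  [/\ [/\ (forall a b c, mul (mul a b) c = mul a (mul b c)),
          (forall a b c, mul (a + b) c = mul a c + mul b c),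
          (forall a b c, mul a (b + c) = mul a b + mul a c) &
          (forall (k : R[i]) a b, mul (k *: a) b = k *: mul a b /\ mul a (k *: b) = k *: mul a b)],
      (forall a, mul one a = a /\ mul a one = a),
      one <> 0,
      [/\ (forall a b, star (a + b) = star a + star b),
          (forall (k : R[i]) a, star (k *: a) = k^* *: star a),
          (forall a, star (star a) = a) &
          (forall a b, star (mul a b) = mul (star b) (star a))] &
      [/\ (forall a b, `|mul a b| <= `|a| * `|b|) &
          (forall a, `|mul (star a) a| = `|a| ^+ 2)]].

Definition compact_group (G : topologicalType) (gmul : G -> G -> G)
  (ginv : G -> G) (e : G) : Prop :=
  [/\ [/\ (forall x y z, gmul (gmul x y) z = gmul x (gmul y z)),
          (forall x, gmul e x = x /\ gmul x e = x) &
          (forall x, gmul (ginv x) x = e /\ gmul x (ginv x) = e)],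
      continuous (fun p : G * G => gmul p.1 p.2),
      continuous ginv,
      hausdorff_space G &
      compact [set: G]].

Definition star_automorphism (R : realType) (A : completeNormedModType R[i])
  (mul : A -> A -> A) (one : A) (star : A -> A) (f : A -> A) : Prop :=
  [/\ (forall a b, f (a + b) = f a + f b),
      (forall (k : R[i]) a, f (k *: a) = k *: f a),
      (forall a b, f (mul a b) = mul (f a) (f b)),
      f one = one &
      (forall a, f (star a) = star (f a)) /\ bijective f].

Definition strongly_continuous_action (R : realType) (A : completeNormedModType R[i])
  (mul : A -> A -> A) (one : A) (star : A -> A)
  (G : topologicalType) (gmul : G -> G -> G) (e : G) (alpha : G -> A -> A) : Prop :=
  [/\ (forall x, star_automorphism mul one star (alpha x)),
      (forall a, alpha e a = a),
      (forall x y a, alpha (gmul x y) a = alpha x (alpha y a)) &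
      (forall a, continuous (fun x => alpha x a))].

Definition ergodic (R : realType) (A : completeNormedModType R[i]) (one : A)
  (G : Type) (alpha : G -> A -> A) : Prop :=
  forall a, (forall x, alpha x a = a) -> exists c : R[i], a = c *: one.

Definition length_function (R : realType) (G : topologicalType)
  (gmul : G -> G -> G) (ginv : G -> G) (e : G) (l : G -> R) : Prop :=
  [/\ continuous l,
      (forall x, 0 <= l x),
      (forall x y, l (gmul x y) <= l x + l y),
      (forall x, l (ginv x) = l x) &
      (forall x, l x = 0 <-> x = e)].

(* L(a) = sup { ||alpha_x(a) - a|| / l(x) : x <> e }, in \bar R (may be +oo).
   The value 0 is adjoined to the set so that L(a) = 0 when G = {e}
   (all quotients are >= 0, so this does not change the sup otherwise). *)
Definition Lip_seminorm (R : realType) (A : completeNormedModType R[i])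
  (G : Type) (e : G) (alpha : G -> A -> A) (l : G -> R) (a : A) : \bar R :=
  ereal_sup ([set 0%E] `|`
    [set (complex.Re (`|alpha x a - a|) / l x)%:E | x in [set x | x <> e]]).

Definition cstar_positive (R : realType) (A : completeNormedModType R[i])
  (mul : A -> A -> A) (star : A -> A) (a : A) : Prop :=
  exists b, a = mul (star b) b.

(* State space S(V) of an order-unit space V (a real subspace of A_sa
   containing one, with the order inherited from A).  States are represented
   as functions A -> R; only their values on V matter. *)
Definition state_space (R : realType) (A : completeNormedModType R[i])
  (mul : A -> A -> A) (one : A) (star : A -> A) (V : set A) : set (A -> R) :=
  [set mu | [/\ (forall a b, V a -> V b -> mu (a + b) = mu a + mu b),
                (forall (r : R) a, V a -> mu (r%:C *: a) = r * mu a),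
                (forall a, V a -> cstar_positive mul star a -> 0 <= mu a) &
                mu one = 1]].

Definition rhoL (R : realType) (A : Type) (V : set A) (L : A -> \bar R)
  (mu nu : A -> R) : \bar R :=
  ereal_sup [set (`|mu a - nu a|)%:E | a in [set a | V a /\ (L a <= 1%:E)%E]].

Definition rhoL_open (R : realType) (A : Type) (V : set A) (L : A -> \bar R)
  (S : set (A -> R)) (U : set (A -> R)) : Prop :=
  U `<=` S /\
  forall mu, U mu -> exists2 eps : R, 0 < eps &
    forall nu, S nu -> (rhoL V L mu nu < eps%:E)%E -> U nu.

Definition weakstar_open (R : realType) (A : Type) (V : set A)
  (S : set (A -> R)) (U : set (A -> R)) : Prop :=
  U `<=` S /\
  forall mu, U mu -> exists (F : set A) (eps : R),
    [/\ finite_set F, F `<=` V, 0 < eps &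
      forall nu, S nu -> (forall a, F a -> `|nu a - mu a| < eps) -> U nu].

Definition is_Lip_norm (R : realType) (A : completeNormedModType R[i])
  (mul : A -> A -> A) (one : A) (star : A -> A) (V : set A) (L : A -> \bar R)
  : Prop :=
  [/\ (forall a, V a -> star a = a),
      V one,
      (forall a b, V a -> V b -> V (a + b)),
      (forall (r : R) a, V a -> V (r%:C *: a)) &
   [/\ (forall a, V a -> exists c : R, L a = c%:E),
       (forall a b, V a -> V b -> (L (a + b)%R <= L a + L b)%E),
       (forall (r : R) a, V a -> L (r%:C *: a) = (`|r|%:E * L a)%E),
       L one = 0%E &
       (forall U, U `<=` state_space mul one star V ->
          rhoL_open V L (state_space mul one star V) U <->
          weakstar_open V (state_space mul one star V) U)]].

(* Main.v *)
(* No Haar measure is needed: all integrals over the group are uniform averages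
   over finite families.  Averaging over a net of the group that is fine for a
   conjugation-invariant notion of closeness contracts the displacement
   sup_x |x.b - b| of every element b, so suitable iterated averages converge
   on the whole algebra to invariant elements, hence, by ergodicity, to scalars;
   this gives the invariant state t.

   For a set W of group elements whose translates by m elements cover the
   group, let g be the average of x.a over those x of a fine average that lie in
   W.  Cauchy-Schwarz yields |g|^2 <= m t(a^2), so for Lipschitz self-adjoint
   elements (where g is close to a) norm separation implies separation for
   t(a^2).  If the Lipschitz ball were not totally bounded modulo scalars, the
   pigeonhole principle would give arbitrarily many differences d_i of elements
   of the ball that are nearly orthogonal for t and have t(d_i^2) bounded below;
   but the operator-valued Bessel inequality for the functions x -> x.d_i bounds
   their number.  Total boundedness modulo scalars makes the metric rho_L and
   the weak-* topology agree on states. *)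
Require Import Defs.
From HB Require Import structures.
From mathcomp Require Import all_boot all_order all_algebra.
From mathcomp Require Import all_classical all_reals all_analysis.
From mathcomp Require Import complex.
From mathcomp Require Import ring lra.
From Stdlib Require Ncring Ncring_tac.
Import Order.TTheory GRing.Theory Num.Theory numFieldNormedType.Exports.
Local Open Scope classical_set_scope.
Local Open Scope ring_scope.
Local Open Scope complex_scope.
Set Implicit Arguments.
Unset Strict Implicit.
Unset Printing Implicit Defensive.

(** Most order arguments rest on one construction, the square root of [1 - h] for [nrm h < 1].
    Because this bound is strict, a positive element gets a root only after a shift by some [d > 0],
    and conclusions are reached by letting [d] tend to 0.

    The obstacle is noncommutativity. The Bessel argument sums [star X * X] for elements [X] that
    are not self-adjoint, so [t] must be nonnegative on every [star z * z] and not just on squares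
    of self-adjoint elements; this is why the positivity of [star z * z] is established first. The
    Bessel coefficients are themselves elements of [A], and the cross terms have the form
    [g i * avg s (d i * d j) * g j]. Ergodicity enters here a second time: the average in the middle
    is nearly a scalar, the value of the invariant state.

    Two sets [W] are needed in turn. The first turns norm separation into a lower bound on
    [t (a * a)]; the tolerance of the second depends on that lower bound. *)

#[local] Instance nc_ops (A : pzRingType) :
  @Ncring.Ring_ops A 0 1 +%R *%R (fun x y => x - y) -%R eq := {}.
#[local] Instance nc_ring (A : pzRingType) : Ncring.Ring (Ro := nc_ops A).
Proof.
constructor; try exact _; try by move=> ? ? -> ? ? ->.
- exact: add0r.
- exact: addrC.
- exact: addrA.
- exact: mul1r.
- exact: mulr1.
- exact: mulrA.
- by move=> x y z; exact: mulrDl.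
- by move=> x y z; exact: mulrDr.
- by [].
- exact: subrr.
Qed.
(** Terms [r *: a] and [r%:A] are atoms for this tactic, and the centrality of [ii] is unknown to
    it; such factors are therefore rearranged by hand around its calls. *)
Ltac nc_ring := Ncring_tac.non_commutative_ring.

(** * Real form of a C*-algebra *)

(* The complex structure is carried by the central element [ii], so that all
   scalars and norms are real. *)
Record real_cstar (R : realType) := RealCstar {
  cstar_sort :> algType R;
  star : cstar_sort -> cstar_sort;
  nrm : cstar_sort -> R;
  ii : cstar_sort;
  nrm_ge0 : forall a, 0 <= nrm a;
  nrm_eq0 : forall a, nrm a = 0 -> a = 0;
  nrmD : forall a b, nrm (a + b) <= nrm a + nrm b;
  nrmZ : forall r a, nrm (r *: a) = `|r| * nrm a;
  nrmM : forall a b, nrm (a * b) <= nrm a * nrm b;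
  nrm_star_mul : forall a, nrm (star a * a) = nrm a ^+ 2;
  nrm_complete : forall u : nat -> cstar_sort,
    (forall eps, 0 < eps ->
       exists N, forall m n, (N <= m)%N -> (N <= n)%N -> nrm (u m - u n) <= eps) ->
    exists l, forall eps, 0 < eps ->
       exists N, forall n, (N <= n)%N -> nrm (u n - l) <= eps;
  starD : forall a b, star (a + b) = star a + star b;
  starZ : forall r a, star (r *: a) = r *: star a;
  starK : forall a, star (star a) = a;
  starM : forall a b, star (a * b) = star b * star a;
  ii_sqr : ii * ii = -1;
  star_ii : star ii = - ii;
  ii_comm : forall a, ii * a = a * ii
}.

Definition nrm_lim (R : realType) (A : real_cstar R) (u : nat -> A) (l : A) :=
  forall eps, 0 < eps ->
    exists N, forall n, (N <= n)%N -> nrm (u n - l) <= eps.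

Section Cstar.
Variables (R : realType) (A : real_cstar R).
Implicit Types (a b h p q w y z : A) (r s t : R).

Local Notation star := (@star R A).
Local Notation nrm := (@nrm R A).

Definition sa a := star a = a.

Lemma ler_gtP r s : (forall d, 0 < d -> r <= s + d) -> r <= s.
Proof. by move=> H; apply/ler_addgt0Pr. Qed.

Lemma nrm0 : nrm 0 = 0.
Proof. by rewrite -(scale0r (0 : A)) nrmZ normr0 mul0r. Qed.

Lemma nrmN a : nrm (- a) = nrm a.
Proof. by rewrite -scaleN1r nrmZ normrN1 mul1r. Qed.

Lemma nrmBC a b : nrm (a - b) = nrm (b - a).
Proof. by rewrite -nrmN opprB. Qed.

Lemma nrmB a b : nrm (a - b) <= nrm a + nrm b.
Proof. by rewrite -(nrmN b) nrmD. Qed.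

Lemma nrm_dist3 a b c : nrm (a - c) <= nrm (a - b) + nrm (b - c).
Proof. by rewrite -(subrKA b a) nrmD. Qed.

Lemma nrm_sum (I : Type) (s : seq I) (P : pred I) (F : I -> A) :
  nrm (\sum_(i <- s | P i) F i) <= \sum_(i <- s | P i) nrm (F i).
Proof.
elim/big_rec2: _ => [|i x y _ h]; first by rewrite nrm0.
by rewrite (le_trans (nrmD _ _)) // lerD2l.
Qed.

Lemma star0 : star 0 = 0.
Proof. by rewrite -(scale0r (0 : A)) starZ !scale0r. Qed.

Lemma starN a : star (- a) = - star a.
Proof. by rewrite -scaleN1r starZ scaleN1r. Qed.

Lemma starB a b : star (a - b) = star a - star b.
Proof. by rewrite starD starN. Qed.

Lemma star1 : star 1 = 1.
Proof. by have := starM (star 1) 1; rewrite mulr1 !starK mulr1 => <-. Qed.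

Lemma star_alg r : star r%:A = r%:A.
Proof. by rewrite starZ star1. Qed.

Lemma star_sum (I : Type) (s : seq I) (P : pred I) (F : I -> A) :
  star (\sum_(i <- s | P i) F i) = \sum_(i <- s | P i) star (F i).
Proof. by apply: (big_morph star); [exact: starD|exact: star0]. Qed.

Lemma nrm1 : nrm 1 = 1.
Proof.
have := nrm_star_mul (1 : A); rewrite star1 mulr1 expr2 -{1}(mulr1 (nrm 1)).
have n1 : nrm 1 != 0 by apply/eqP => /nrm_eq0/eqP; rewrite oner_eq0.
by move/(mulfI n1)/esym.
Qed.

Lemma nrm_alg r : nrm r%:A = `|r|.
Proof. by rewrite nrmZ nrm1 mulr1. Qed.

Lemma nrm_star a : nrm (star a) = nrm a.
Proof.
suff H b : nrm b <= nrm (star b).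
  by apply/le_anti; rewrite H andbT -{2}(starK a) H.
have [->|b0] := eqVneq b 0; first by rewrite star0.
have nb : 0 < nrm b.
  by rewrite lt_neqAle nrm_ge0 andbT; apply: contra_neq b0 => /esym/nrm_eq0.
by rewrite -(ler_pM2r nb) -expr2 -nrm_star_mul nrmM.
Qed.

Lemma nrmX a n : nrm (a ^+ n) <= nrm a ^+ n.
Proof.
elim: n => [|n IH]; first by rewrite !expr0 nrm1.
by rewrite !exprS (le_trans (nrmM _ _)) // ler_wpM2l // nrm_ge0.
Qed.

Lemma nrm_sa_sqr a : sa a -> nrm (a * a) = nrm a ^+ 2.
Proof. by move=> sa_a; rewrite -{1}sa_a nrm_star_mul. Qed.

Lemma saX a n : sa a -> sa (a ^+ n).
Proof.
move=> sa_a; elim: n => [|n IH]; first by rewrite /sa expr0 star1.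
by rewrite /sa exprS starM IH sa_a -exprSr -exprS.
Qed.

Lemma nrm_sa_exp2 a k : sa a -> nrm (a ^+ (2 ^ k)) = nrm a ^+ (2 ^ k).
Proof.
move=> sa_a; elim: k => [|k IH]; first by rewrite !expr1.
rewrite expnSr !exprM -IH -nrm_sa_sqr ?expr2 //; exact: saX.
Qed.

Lemma comm_scale a b r : GRing.comm a b -> GRing.comm a (r *: b).
Proof. by rewrite /GRing.comm => h; rewrite -scalerAr -scalerAl h. Qed.

Lemma commr_alg a r : GRing.comm a r%:A.
Proof. by apply: comm_scale; exact: commr1. Qed.

Lemma limit_unique (u : nat -> A) a b :
  nrm_lim u a -> nrm_lim u b -> a = b.
Proof.
move=> ua ub; apply/eqP; rewrite -subr_eq0; apply/eqP/nrm_eq0/le_anti.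
rewrite nrm_ge0 andbT; apply: ler_gtP => d d0; rewrite add0r.
have d20 : 0 < d / 2 by rewrite divr_gt0.
have [N1 /(_ (maxn N1 _) (leq_maxl _ _)) h1] := ua _ d20.
have [N2 /(_ (maxn _ N2) (leq_maxr _ _)) h2] := ub _ d20.
apply: le_trans (nrm_dist3 _ (u (maxn N1 N2)) _) _.
by rewrite nrmBC (splitr d) lerD.
Qed.

Lemma geometric_cauchy (u : nat -> A) (c r : R) : 0 <= r < 1 ->
  (forall n, nrm (u n.+1 - u n) <= c * r ^+ n) ->
  exists l, nrm_lim u l.
Proof.
move=> /andP[r0 r1] uS.
have c0 : 0 <= c.
  by have := uS 0%N; rewrite expr0 mulr1; apply: le_trans; exact: nrm_ge0.
have r1' : 0 < 1 - r by rewrite subr_gt0.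
have ukn k n : nrm (u (n + k)%N - u n) <= c * r ^+ n * (1 - r ^+ k) / (1 - r).
  elim: k => [|k IH]; first by rewrite addn0 subrr nrm0 expr0 subrr mulr0 mul0r.
  apply: le_trans (nrm_dist3 _ (u (n + k)%N) _) _; rewrite addnS.
  apply: le_trans (lerD (uS _) IH) _.
  rewrite ler_pdivlMr // mulrDl divfK ?gt_eqF// exprD exprS le_eqVlt.
  by apply/orP; left; apply/eqP; ring.
apply: nrm_complete => eps eps0.
have [N _ /(_ N (leqnn N)) hN] : \forall n \near \oo,
    `|c * r ^+ n / (1 - r)| < eps / 2.
  have /cvgrPdist_lt/(_ (eps / 2)) :
      (fun n => c * r ^+ n / (1 - r)) @ \oo --> c * 0 / (1 - r).
    apply: cvgM; [apply: cvgM; [exact: cvg_cst|apply: cvg_expr]|exact: cvg_cst].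
    by rewrite ger0_norm.
  rewrite mulr0 mul0r.
  rewrite divr_gt0 // => /(_ isT); apply: filterS => n.
  by rewrite sub0r normrN.
exists N => m n Nm Nn.
have uN k : (N <= k)%N -> nrm (u k - u N) <= eps / 2.
  move=> /subnKC <-; apply: le_trans (ukn _ _) _; apply: ltW.
  apply: le_lt_trans hN; apply: le_trans (ler_norm _).
  rewrite ler_pM2r ?invr_gt0 // ler_piMr ?mulr_ge0 ?exprn_ge0 //.
  by rewrite gerBl exprn_ge0.
apply: le_trans (nrm_dist3 _ (u N) _) _.
by rewrite [nrm (u N - _)]nrmBC (splitr eps) lerD ?uN.
Qed.

End Cstar.

(** * Positive elements *)

Section Positivity.
Variables (R : realType) (A : real_cstar R).
Implicit Types (a b h p q w y z : A) (r s t : R).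

Local Notation star := (@star R A).
Local Notation nrm := (@nrm R A).
Local Notation ii := (ii A).

Lemma lim_lipschitz (u v : nat -> A) a b c : 0 <= c ->
  (forall n, nrm (v n - b) <= c * nrm (u n - a)) -> nrm_lim u a -> nrm_lim v b.
Proof.
move=> c0 uv ua eps eps0; have c1 : 0 < c + 1 by rewrite ltr_wpDl.
have [N hN] := ua _ (divr_gt0 eps0 c1); exists N => n /hN h.
apply: le_trans (uv n) _; rewrite ler_pdivlMr // mulrC in h.
by apply: le_trans h; rewrite ler_wpM2r ?nrm_ge0 // lerDl.
Qed.

Lemma nrm_lim_le (u : nat -> A) a c :
  nrm_lim u a -> (forall n, nrm (u n) <= c) -> nrm a <= c.
Proof.
move=> ua uc; apply: ler_gtP => d /ua[N /(_ N (leqnn N)) h].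
by rewrite -(subKr (u N) a) (le_trans (nrmB _ _)) // lerD.
Qed.

(* With [w = 1 - y] the equation [w ^ 2 = 1 - h] says that [y] is a fixed
   point of [y |-> (h + y ^ 2) / 2], a contraction of the ball of radius
   [nrm h]. *)
Lemma sqrt_1B h : sa h -> nrm h < 1 ->
  exists w, [/\ sa w, w * w = 1 - h, nrm (1 - w) <= 1 &
                forall b, GRing.comm b h -> GRing.comm b w].
Proof.
move=> sah h1; set r := nrm h in h1; have r0 : 0 <= r := nrm_ge0 h.
pose f y := 2^-1 *: (h + y * y).
pose u n := iter n f 0.
have u_le n : nrm (u n) <= r.
  elim: n => [|n IH]; first by rewrite /= nrm0.
  rewrite /= nrmZ ger0_norm ?invr_ge0 //.
  have : nrm (h + u n * u n) <= r + r * r.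
    apply: le_trans (nrmD _ _) _; rewrite lerD2l.
    by apply: le_trans (nrmM _ _) _; rewrite ler_pM ?nrm_ge0.
  by rewrite -/r; nra.
have f_lip y z : nrm y <= r -> nrm z <= r -> nrm (f y - f z) <= r * nrm (y - z).
  move=> yr zr; rewrite /f -scalerBr nrmZ ger0_norm ?invr_ge0 //.
  have -> : h + y * y - (h + z * z) = y * (y - z) + (y - z) * z by nc_ring.
  have : nrm (y * (y - z) + (y - z) * z) <= r * nrm (y - z) + r * nrm (y - z).
    apply: le_trans (nrmD _ _) (lerD _ _); apply: le_trans (nrmM _ _) _.
      by rewrite ler_wpM2r ?nrm_ge0.
    by rewrite mulrC ler_wpM2r ?nrm_ge0.
  by move=> ?; lra.
have [l ul] : exists l, nrm_lim u l.
  apply: (@geometric_cauchy _ _ _ r r); first by rewrite r0.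
  elim=> [|n IH]; last first.
    apply: le_trans (f_lip _ _ (u_le n.+1) (u_le n)) _.
    by rewrite exprS ler_wpM2l.
  by rewrite expr0 mulr1 subr0 u_le.
have l_le : nrm l <= r by apply: nrm_lim_le ul u_le.
have fl : f l = l.
  apply: (@limit_unique _ _ (fun n => u n.+1)).
    by apply: lim_lipschitz r0 _ ul => n; exact: f_lip.
  by move=> eps /ul[N hN]; exists N => n Nn; apply: hN; rewrite leqW.
have ll : l * l = 2 *: l - h.
  by rewrite -{3}fl /f scalerA divff // scale1r addrC addKr.
exists (1 - l); split.
- apply: (@limit_unique _ _ (fun n => star (1 - u n))); last first.
    apply: (@lim_lipschitz u _ l _ 1) => // n; rewrite mul1r.
    suff -> : star (1 - u n) = 1 - u n.
      by rewrite opprB addrC subrKA -nrmN opprB.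
    rewrite starB star1; congr (_ - _).
    by elim: n => [|n IH]; rewrite /= ?star0 // starZ starD starM sah IH.
  apply: (@lim_lipschitz u _ l _ 1) => // n; rewrite mul1r.
  by rewrite -starB nrm_star opprB addrC subrKA -nrmN opprB.
- have -> : (1 - l) * (1 - l) = 1 - l - l + l * l by nc_ring.
  rewrite ll scaler_nat mulr2n; nc_ring.
- by rewrite opprB addrC subrK (le_trans l_le) // ltW.
move=> b bh; apply: commrB; first exact: commr1.
apply: (@limit_unique _ _ (fun n => b * u n)).
  apply: (lim_lipschitz (nrm_ge0 b) _ ul) => n.
  by rewrite -mulrBr nrmM.
apply: (lim_lipschitz (nrm_ge0 b) _ ul) => n.
suff -> : b * u n = u n * b by rewrite -mulrBl mulrC nrmM.
elim: n => [|n IH]; first by rewrite /= mulr0 mul0r.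
by apply: comm_scale; apply: commrD => //; apply: commrM.
Qed.

(** Rescaling of [sqrt_1B] by [t]. The existential clause is the norm condition of [Pos], so the
    root is itself positive. *)
Lemma sqrt_BZ h t : sa h -> nrm h < t ->
  exists w, [/\ sa w, w * w = t%:A - h,
                exists2 s, 0 <= s & nrm (s%:A - w) <= s &
                forall b, GRing.comm b h -> GRing.comm b w].
Proof.
move=> sah ht; have t0 : 0 < t by apply: le_lt_trans ht; exact: nrm_ge0.
have [|| w [saw ww w1 wC]] := @sqrt_1B (t^-1 *: h).
- by rewrite /sa starZ sah.
- by rewrite nrmZ gtr0_norm ?invr_gt0 // ltr_pdivrMl // mulr1.
exists (Num.sqrt t *: w); split.
- by rewrite /sa starZ saw.
- rewrite -scalerAl -scalerAr scalerA -expr2 sqr_sqrtr ?ltW // ww scalerBr.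
  by rewrite scalerA divff ?gt_eqF // scale1r.
- exists (Num.sqrt t); first exact: sqrtr_ge0.
  rewrite -scalerBr nrmZ ger0_norm ?sqrtr_ge0 //.
  by rewrite ler_piMr ?sqrtr_ge0.
by move=> b bh; apply/comm_scale/wC/comm_scale.
Qed.

(* [k + i w] is then [sqrt t] times a unitary. *)
Lemma nrm_le_of_sum_sqr k w t : sa k -> sa w -> GRing.comm k w -> 0 <= t ->
  k * k + w * w = t%:A -> nrm k ^+ 2 <= t.
Proof.
move=> sak saw kw t0 e; pose z := k + ii * w.
have sz : star z = k - ii * w.
  by rewrite /z starD starM star_ii sak saw mulrN -ii_comm.
have zz : star z * z = t%:A.
  rewrite sz /z -e.
  have -> : (k - ii * w) * (k + ii * w) =
            k * k + k * ii * w - ii * w * k - ii * (w * ii) * w by nc_ring.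
  rewrite -(ii_comm w) -(ii_comm k) -!mulrA kw (mulrA ii ii) ii_sqr; nc_ring.
have nz : nrm z ^+ 2 = t by rewrite -nrm_star_mul zz nrm_alg ger0_norm.
have nk : nrm k <= nrm z.
  have -> : k = 2^-1 *: (z + star z).
    rewrite sz /z addrACA subrr addr0 scalerDr -scalerDl.
    have -> : 2^-1 + 2^-1 = 1 :> R by lra.
    by rewrite scale1r.
  rewrite nrmZ ger0_norm ?invr_ge0 //.
  by have := nrmD z (star z); rewrite nrm_star; lra.
by rewrite -nz ler_sqr ?nnegrE ?nrm_ge0.
Qed.

(* For self-adjoint [h], [nrm (t - h) <= t] says that the spectrum of [h] lies
   in [0, 2t]; no spectral theory is used. *)
Definition Pos h := sa h /\ exists2 t, 0 <= t & nrm (t%:A - h) <= t.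

Lemma PosD a b : Pos a -> Pos b -> Pos (a + b).
Proof.
move=> [saa [s s0 hs]] [sab [t t0 ht]]; split; first by rewrite /sa starD saa sab.
exists (s + t); first exact: addr_ge0.
by rewrite scalerDl opprD addrACA (le_trans (nrmD _ _)) // lerD.
Qed.

Lemma Pos0 : Pos 0.
Proof. by split; [exact: star0|exists 0; rewrite // scale0r subrr nrm0]. Qed.

Lemma PosZ r a : 0 <= r -> Pos a -> Pos (r *: a).
Proof.
move=> r0 [saa [s s0 hs]]; split; first by rewrite /sa starZ saa.
exists (r * s); first exact: mulr_ge0.
by rewrite -scalerA -scalerBr nrmZ ger0_norm // ler_wpM2l.
Qed.

Lemma Pos_sum (I : Type) (s : seq I) (P : pred I) (F : I -> A) :
  (forall i, P i -> Pos (F i)) -> Pos (\sum_(i <- s | P i) F i).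
Proof. by move=> h; elim/big_ind: _ => //; [exact: Pos0|exact: PosD]. Qed.

Lemma Pos_alg c : 0 <= c -> Pos c%:A.
Proof.
by move=> c0; split; [exact: star_alg|exists c; rewrite // subrr nrm0].
Qed.

Lemma Pos_nrmB c h : sa h -> nrm h <= c -> Pos (c%:A - h).
Proof.
move=> sah hc; split; first by rewrite /sa starB star_alg sah.
by exists c; [apply: le_trans hc; exact: nrm_ge0|rewrite subKr].
Qed.

Lemma Pos_ge c h d : Pos h -> nrm (h - c%:A) <= d -> - d <= c.
Proof.
move=> [_ [t t0 ht]] hc.
have : nrm (t%:A - c%:A) <= t + d.
  by apply: le_trans (nrm_dist3 _ h _) _; rewrite lerD.
by rewrite -scalerBl nrm_alg ler_norml => /andP[_]; lra.
Qed.

(** [sqrt_BZ] wants a strict norm bound, whereas [Pos] supplies [nrm (t%:A - h) <= t]; the shift by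
    [d] buys the strictness. *)
Lemma Pos_sqrt h d : Pos h -> 0 < d ->
  exists p, [/\ sa p, p * p = h + d%:A &
                forall b, GRing.comm b h -> GRing.comm b p].
Proof.
move=> [sah [t t0 ht]] d0.
have [||p [sap pp _ pC]] := @sqrt_BZ (t%:A - h) (t + d).
- by rewrite /sa starB star_alg sah.
- by rewrite (le_lt_trans ht) // ltrDl.
exists p; split => //.
  rewrite pp scalerDl; nc_ring.
by move=> b bh; apply/pC/commrB => //; exact: commr_alg.
Qed.

(** Write [t%:A - p * p] as [w * w]. Since [w * w + p * p] is the scalar [t], [nrm_le_of_sum_sqr]
    bounds [nrm w ^+ 2] by [t]. *)
Lemma nrm_B_sqr p t : sa p -> nrm (p * p) < t -> nrm (t%:A - p * p) <= t.
Proof.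
move=> sap pt; have t0 : 0 < t by apply: le_lt_trans pt; exact: nrm_ge0.
have [|//|w [saw ww _ wC]] := @sqrt_BZ (p * p) t; first by rewrite /sa starM sap.
rewrite -ww nrm_sa_sqr //; apply: (@nrm_le_of_sum_sqr _ p) => //.
- by apply/commr_sym/wC; apply: commrM; exact: commr_refl.
- exact: ltW.
by rewrite ww subrK.
Qed.

Lemma Pos_sqr p : sa p -> Pos (p * p).
Proof.
move=> sap; split; first by rewrite /sa starM sap.
exists (nrm (p * p) + 1); first by rewrite addr_ge0 ?nrm_ge0.
by apply: nrm_B_sqr; rewrite // ltrDl.
Qed.

(** Frees the existential [t] of [Pos]: any [t] above [nrm h] serves. The shifted element [h + e%:A]
    is a square, and [e] is small enough to keep its norm below [t]. *)
Lemma Pos_nrm_B h t : Pos h -> nrm h < t -> nrm (t%:A - h) <= t.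
Proof.
move=> Ph ht; apply: ler_gtP => d d0.
pose e := Num.min d ((t - nrm h) / 2).
have e0 : 0 < e by rewrite lt_min d0 divr_gt0 // subr_gt0.
have eh : nrm h + e < t.
  have : e <= (t - nrm h) / 2 by rewrite ge_min lexx orbT.
  by lra.
have [p [sap pp _]] := Pos_sqrt Ph e0.
apply: le_trans (nrm_dist3 _ (p * p) _) _; apply: lerD.
  apply: nrm_B_sqr => //; rewrite pp; apply: le_lt_trans (nrmD _ _) _.
  by rewrite nrm_alg gtr0_norm.
by rewrite pp addrC addKr nrm_alg gtr0_norm // ge_min lexx.
Qed.

(** Passing to the limit requires a witness of [Pos] that does not depend on [d]; by [Pos_nrm_B],
    [nrm h + 1] is one. *)
Lemma Pos_closed h : sa h -> (forall d, 0 < d -> Pos (h + d%:A)) -> Pos h.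
Proof.
move=> sah hP; split=> //; exists (nrm h + 1); first by rewrite addr_ge0 ?nrm_ge0.
apply: ler_gtP => d d0; pose e := Num.min d 2^-1.
have e0 : 0 < e by rewrite lt_min d0 invr_gt0 ltr0n.
have ed : e <= d by rewrite ge_min lexx.
have e1 : e <= 2^-1 by rewrite ge_min lexx orbT.
have -> : (nrm h + 1)%:A - h = (nrm h + 1)%:A - (h + e%:A) + e%:A by nc_ring.
apply: le_trans (nrmD _ _) (lerD _ _).
  apply: Pos_nrm_B; first exact: hP.
  apply: le_lt_trans (nrmD _ _) _; rewrite nrm_alg gtr0_norm // ltrD2l.
  by lra.
by rewrite nrm_alg gtr0_norm.
Qed.

(** Converts an order bound on [g * g] into a norm bound; this is how Cauchy-Schwarz in the order of
    [A] yields norm estimates. *)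
Lemma Pos_nrm_sqr g c : sa g -> Pos (c%:A - g * g) -> nrm g ^+ 2 <= c.
Proof.
move=> sag Pg; have c0 : 0 <= c.
  rewrite -oppr0; apply: (@Pos_ge _ c%:A 0); last by rewrite subrr nrm0.
  by rewrite -(subrK (g * g) c%:A); apply: PosD => //; exact: Pos_sqr.
apply: ler_gtP => d d0; have [p [sap pp pC]] := Pos_sqrt Pg d0.
apply: (@nrm_le_of_sum_sqr _ p) => //.
- apply: pC; apply: commrB; first exact: commr_alg.
  by apply: commrM; exact: commr_refl.
- by rewrite addr_ge0 // ltW.
by rewrite pp scalerDl; nc_ring.
Qed.

End Positivity.

(** * Positivity of [star z * z] *)

Section StarMul.
Variables (R : realType) (A : real_cstar R).
Implicit Types (a b h p q w y z : A) (r s t : R).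

Local Notation star := (@star R A).
Local Notation nrm := (@nrm R A).
Local Notation ii := (ii A).

Lemma bernoulli (x : R) n : 0 <= x -> 1 + n%:R * x <= (1 + x) ^+ n.
Proof.
move=> x0; elim: n => [|n IH]; first by rewrite mul0r addr0 expr0.
have x1 : 0 <= 1 + x by rewrite addr_ge0.
rewrite exprS; apply: le_trans (ler_wpM2l x1 IH); rewrite -natr1.
have : 0 <= n%:R * x * x by rewrite !mulr_ge0.
by lra.
Qed.

(** Along [n = 2 ^ k] the power [(x / t) ^+ n] grows at most linearly in [n], which forces
    [x / t <= 1]. Powers of two are the exponents covered by [nrm_sa_exp2]. *)
Lemma le_of_exp2_growth (x t c : R) : 0 <= x -> 0 < t -> 0 <= c ->
  (forall k, t * x ^+ (2 ^ k) <= t ^+ (2 ^ k) * (t + (2 ^ k)%:R * c)) -> x <= t.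
Proof.
move=> x0 t0 c0 H; rewrite leNgt; apply/negP => tx.
pose u := x / t - 1; have u0 : 0 < u by rewrite subr_gt0 ltr_pdivlMr // mul1r.
have xE : x = t * (1 + u) by rewrite /u subrKC mulrC divfK // gt_eqF.
have H' k : (1 + u) ^+ (2 ^ k) <= 1 + (2 ^ k)%:R * (c / t).
  have := H k; rewrite xE exprMn mulrCA ler_pM2l ?exprn_gt0 //.
  by rewrite mulrA -[_ <= 1 + _](ler_pM2l t0) mulrDr mulr1
    [_ * (_ / t)]mulrC divfK ?gt_eqF.
(* For [m = 2 ^ k] this gives [m * u ^+ 2 > 2 * (c / t)]. Bernoulli at [m], squared, bounds the
   power [2 * m] below by [(1 + m * u) ^+ 2], which then exceeds [1 + 2 * m * (c / t)]. *)
pose k := Num.truncn (2 * (c / t) / u ^+ 2).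
have kk : 2 * (c / t) / u ^+ 2 < (2 ^ k)%:R.
  apply: lt_le_trans (truncnS_gt _) _; rewrite ler_nat -/k.
  exact: ltn_expl.
rewrite ltr_pdivrMr ?exprn_gt0 // in kk.
have := H' k.+1; rewrite expnS mulnC exprM natrM => h2.
have h1 := @bernoulli u (2 ^ k) (ltW u0).
have ct0 : 0 <= c / t by rewrite divr_ge0 // ltW.
move: (c / t) ct0 ((2 ^ k)%:R) kk h1 h2 (ler0n R (2 ^ k)) => d d0 m kk h1 h2 m0.
have : (1 + m * u) ^+ 2 <= ((1 + u) ^+ (2 ^ k)) ^+ 2.
  by rewrite ler_sqr ?nnegrE //; [rewrite addr_ge0 ?mulr_ge0 // ltW|
    apply: exprn_ge0; rewrite addr_ge0 // ltW].
move=> h3; have h4 := le_trans h3 h2; rewrite expr2 in kk; rewrite expr2 in h4.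
have m_gt0 : 0 < m.
  rewrite lt_neqAle m0 andbT; apply/negP => /eqP m00; move: kk.
  by rewrite -m00 mul0r; lra.
have : m * (2 * d) < m * (m * (u * u)) by rewrite ltr_pM2l.
have : 0 < m * u by rewrite mulr_gt0.
by nra.
Qed.

(* [star y * y] and [y * star y] have the same spectral radius after a shift:
   the norms of [(t - star y * y) ^ n] are controlled by those of
   [(t - y * star y) ^ n] up to a factor linear in [n]. *)
Lemma Pos_swap y d : 0 <= d ->
  Pos (y * star y + d%:A) -> Pos (star y * y + d%:A).
Proof.
move=> d0 Pk; set k := y * star y in Pk; set j := star y * y.
have saj : sa j by rewrite /sa starM starK.
pose T := nrm (k + d%:A) + d + 1; pose t := T - d.
have T0 : 0 < T by have := nrm_ge0 (k + d%:A); rewrite /T; lra.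
have t0 : 0 <= t by have := nrm_ge0 (k + d%:A); rewrite /t /T; lra.
have tT : t <= T by rewrite gerBl.
have kT : nrm (t%:A - k) <= T.
  have -> : t%:A - k = T%:A - (k + d%:A) by rewrite scalerBl; nc_ring.
  by apply: Pos_nrm_B => //; rewrite /T; lra.
pose c := nrm y ^+ 2.
(* From [y * (star y * y) = (y * star y) * y]. Hence [j * (t%:A - j) ^+ n] is
   [star y * (t%:A - k) ^+ n * y], of norm at most [c * T ^+ n]. *)
have jk n : y * (t%:A - j) ^+ n = (t%:A - k) ^+ n * y.
  elim: n => [|n IH]; first by rewrite !expr0 mulr1 mul1r.
  rewrite exprSr mulrA IH exprSr -!mulrA; congr (_ * _).
  rewrite mulrBl mulrBr -(commr_alg y t) /k /j; nc_ring.
have jn n : T * nrm ((t%:A - j) ^+ n) <= T ^+ n * (T + n%:R * c).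
  elim: n => [|n IH]; first by rewrite !expr0 nrm1 mul0r addr0 mulr1 mul1r.
  have jx : nrm (j * (t%:A - j) ^+ n) <= c * T ^+ n.
    rewrite /j -mulrA jk; apply: le_trans (nrmM _ _) _; rewrite nrm_star.
    rewrite /c expr2 -mulrA ler_wpM2l ?nrm_ge0 // mulrC.
    apply: le_trans (nrmM _ _) _; rewrite ler_wpM2r ?nrm_ge0 //.
    apply: le_trans (nrmX _ _) _.
    by rewrite lerXn2r ?nnegrE ?nrm_ge0 // ltW.
  have : nrm ((t%:A - j) ^+ n.+1) <=
         T * nrm ((t%:A - j) ^+ n) + c * T ^+ n.
    rewrite exprS mulrBl; apply: le_trans (nrmB _ _) (lerD _ jx).
    by rewrite mulr_algl nrmZ ger0_norm // ler_wpM2r ?nrm_ge0.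
  move=> /(ler_wpM2l (ltW T0)); move=> h; apply: le_trans h _.
  rewrite mulrDr exprS -natr1.
  have := ler_wpM2l (ltW T0) IH.
  by rewrite !mulrDr mulrDl; lra.
split; first by rewrite /sa starD star_alg saj.
exists T; first exact: ltW.
have -> : T%:A - (j + d%:A) = t%:A - j by rewrite scalerBl; nc_ring.
apply: (@le_of_exp2_growth _ _ c) => //; first exact: nrm_ge0.
  exact: sqr_ge0.
have satj : sa (t%:A - j) by rewrite /sa starB star_alg saj.
by move=> n; rewrite -(nrm_sa_exp2 n satj); exact: jn.
Qed.

(** With [s * s = p + e%:A] and [s] commuting with [q], the element is the square of [q * s] minus
    [e *: (q * q)], an error of norm at most [d] by the choice of [e]. *)
Lemma Pos_conj_comm p q : Pos p -> sa q -> GRing.comm q p -> Pos (q * p * q).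
Proof.
move=> Pp saq qp; apply: Pos_closed.
  by rewrite /sa !starM saq Pp.1 mulrA.
move=> d d0; have n1 : 0 < nrm (q * q) + 1 by rewrite ltr_wpDl ?nrm_ge0.
pose e := d / (nrm (q * q) + 1); have e0 : 0 < e by rewrite divr_gt0.
have [s [sas ss sC]] := Pos_sqrt Pp e0.
have qs : q * s = s * q by apply: sC.
have -> : q * p * q + d%:A = (q * s) * (q * s) + (d%:A - e *: (q * q)).
  have -> : q * s * (q * s) = q * (s * s) * q by rewrite {2}qs !mulrA.
  by rewrite ss mulrDr mulrDl mulr_algr -scalerAl; nc_ring.
apply: PosD; first by apply: Pos_sqr; rewrite /sa starM sas saq.
apply: Pos_nrmB; first by rewrite /sa starZ starM saq.
rewrite nrmZ gtr0_norm // /e mulrAC ler_pdivrMr // ler_wpM2l ?(ltW d0) //.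
by rewrite lerDl.
Qed.

Lemma PosM_comm a b : Pos a -> Pos b -> GRing.comm b a -> Pos (a * b).
Proof.
move=> Pa Pb ba; apply: Pos_closed; first by rewrite /sa starM Pa.1 Pb.1.
move=> d d0; have n1 : 0 < nrm b + 1 by rewrite ltr_wpDl ?nrm_ge0.
pose e := d / (nrm b + 1); have e0 : 0 < e by rewrite divr_gt0.
have [s [sas ss sC]] := Pos_sqrt Pa e0.
have bs : b * s = s * b by apply: sC.
have -> : a * b + d%:A = s * b * s + (d%:A - e *: b).
  have -> : s * b * s = s * s * b by rewrite -mulrA bs mulrA.
  by rewrite ss mulrDl mulr_algl; nc_ring.
apply: PosD; first by apply: Pos_conj_comm => //; exact/commr_sym.
apply: Pos_nrmB; first by rewrite /sa starZ Pb.1.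
rewrite nrmZ gtr0_norm // /e mulrAC ler_pdivrMr // ler_wpM2l ?(ltW d0) //.
by rewrite lerDl.
Qed.

(** Half the sum of the squares of [a] and [b], which up to sign are twice the real and imaginary
    parts of [y]. *)
Lemma Pos_star_mulD y : Pos (star y * y + y * star y).
Proof.
pose a := y + star y; pose b := ii * (y - star y).
have saa : sa a by rewrite /sa starD starK addrC.
have sab : sa b.
  by rewrite /sa starM starB starK star_ii mulrN -mulNr opprB -ii_comm.
have -> : star y * y + y * star y = 2^-1 *: (a * a + b * b).
  have -> : b * b = - ((y - star y) * (y - star y)).
    rewrite /b mulrA -(mulrA ii _ ii) -(ii_comm (y - _)) (mulrA ii ii) ii_sqr.
    by rewrite mulN1r mulNr.
  have -> : a * a - (y - star y) * (y - star y) =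
     (star y * y + y * star y) + (star y * y + y * star y).
    by rewrite /a; nc_ring.
  rewrite scalerDr -scalerDl; have -> : 2^-1 + 2^-1 = 1 :> R by lra.
  by rewrite scale1r.
apply: PosZ; first by rewrite invr_ge0.
by apply: PosD; exact: Pos_sqr.
Qed.

(* Kaplansky's argument with [p ~ |h|] and [q = p - h ~ 2 h_-]: for [y = z q]
   the element [star y * y ~ - q p q] is nearly negative, but nearly positive by
   [Pos_swap]; hence [q] is small. *)
Lemma Pos_star_mul z : Pos (star z * z).
Proof.
set h := star z * z.
have sah : sa h by rewrite /sa starM starK.
apply: Pos_closed => // eta eta0.
pose n := nrm h; have n0 : 0 <= n := nrm_ge0 h.
pose c := 2 * n + 2; have c1 : 1 <= c by rewrite /c; lra.
(* Chosen for the end: as [d <= 1 <= c], the bound [8 * d * c ^+ 2 + d ^+ 2] on [nrm q ^+ 4] is at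
   most [9 * d * c ^+ 2], hence at most [eta ^+ 4]. *)
pose d := Num.min 1 (eta ^+ 4 / (9 * c ^+ 2)).
have c20 : 0 < 9 * c ^+ 2 by rewrite mulr_gt0 // exprn_gt0 // (lt_le_trans ltr01).
have d0 : 0 < d by rewrite lt_min ltr01 divr_gt0 // exprn_gt0.
have d1 : d <= 1 by rewrite ge_min lexx.
have d_eta : d * (9 * c ^+ 2) <= eta ^+ 4.
  by rewrite -ler_pdivlMr // ge_min lexx orbT.
pose t := nrm (h * h) + d + 1.
have sahh : sa (h * h) by rewrite /sa starM sah.
have hC : GRing.comm h ((t - d)%:A - h * h).
  by apply: commrB; [exact: commr_alg|exact: commrM].
have [||p [sap pp Pp pC]] := @sqrt_BZ _ A ((t - d)%:A - h * h) t.
- by rewrite /sa starB star_alg sahh.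
- apply: le_lt_trans (_ : _ <= t - d) _; last by rewrite gtrBl.
  by apply: nrm_B_sqr => //; rewrite /t; lra.
have {}Pp : Pos p by split.
have hp : h * p = p * h by exact: pC.
have {}pp : p * p = h * h + d%:A by rewrite pp scalerBl; nc_ring.
have np : nrm p <= n + 1.
  rewrite -ler_sqr ?nnegrE ?nrm_ge0 ?addr_ge0 // -nrm_sa_sqr // pp.
  apply: le_trans (nrmD _ _) _; rewrite nrm_alg gtr0_norm // nrm_sa_sqr // -/n.
  by rewrite !expr2; nra.
pose q := p - h; have saq : sa q by rewrite /sa starB sap sah.
have qp : q * p = p * q by rewrite /q mulrBl mulrBr hp.
(* This is [(p - h) * (p + h) = d], the approximate form of the orthogonality of the positive and
   negative parts of [h]. *)
have qh : q * h = d%:A - q * p.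
  apply/eqP; rewrite eq_sym subr_eq addrC -mulrDr /q; apply/eqP.
  have -> : (p - h) * (p + h) = p * p + (p * h - h * p) - h * h by nc_ring.
  by rewrite hp subrr pp; nc_ring.
have nq : nrm q <= c.
  by apply: le_trans (nrmB _ _) _; rewrite -/n /c; lra.
have PP : Pos (q * p * q) by exact: Pos_conj_comm.
set P := q * p * q in PP.
have Pdq : Pos ((d * c)%:A - d *: q).
  rewrite -scalerA -scalerBr; apply: PosZ; first exact: ltW.
  exact: Pos_nrmB.
pose y := z * q.
have yy : star y * y = d *: q - P.
  have -> : star y * y = q * h * q by rewrite /y starM saq /h !mulrA.
  by rewrite qh mulrBl mulr_algl.
have : Pos (y * star y + (d * c)%:A).
  have -> : y * star y + (d * c)%:A =
      (star y * y + y * star y) + P + ((d * c)%:A - d *: q).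
    by rewrite yy; nc_ring.
  by apply: PosD => //; apply: PosD => //; exact: Pos_star_mulD.
have dc0 : 0 <= d * c by rewrite mulr_ge0 ?ltW // (lt_le_trans ltr01).
move=> /(Pos_swap dc0); rewrite yy => Py.
have {}Py : Pos ((2 * (d * c))%:A - P).
  have -> : (2 * (d * c))%:A - P = (d *: q - P + (d * c)%:A) +
      ((d * c)%:A - d *: q).
    by rewrite mulr_natl mulr2n scalerDl; nc_ring.
  exact: PosD.
have qq : q * q = q * p + q * p - d%:A.
  by rewrite {2}/q mulrBr qh; nc_ring.
have Pqp : Pos (q * p).
  have -> : q * p = 2^-1 *: (q * q + d%:A).
    rewrite qq subrK scalerDr -scalerDl; have -> : 2^-1 + 2^-1 = 1 :> R by lra.
    by rewrite scale1r.
  apply: PosZ; first by rewrite invr_ge0.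
  by apply: PosD; [exact: Pos_sqr|apply/Pos_alg/ltW].
have PpP : Pos (p * ((2 * (d * c))%:A - P)).
  apply: PosM_comm => //; apply: commr_sym; apply: commrB; first exact: commr_alg.
  by do 2?apply: commrM => //.
(* Here [q * q = 2 * (q * p) - d] squares to [4 * (q * p) ^ 2] plus small terms, and
   [(q * p) ^ 2 = p * P] is controlled by the upper bound [2 * (d * c)] on [P]. *)
have q4 : nrm (q * q) ^+ 2 <= 8 * d * c ^+ 2 + d ^+ 2.
  apply: Pos_nrm_sqr; first by rewrite /sa starM saq.
  have -> : (8 * d * c ^+ 2 + d ^+ 2)%:A - q * q * (q * q) =
      4 *: (p * ((2 * (d * c))%:A - P)) + (8 * d * c) *: (c%:A - p) +
      (4 * d) *: (q * p).
    have pP : p * P = q * p * (q * p).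
      by rewrite /P -[q * p * q]mulrA mulrA -qp.
    set m := q * p in qq pP *.
    have -> : q * q * (q * q) = 4 *: (m * m) - (4 * d) *: m + (d ^+ 2)%:A.
      rewrite qq; have -> : (m + m - d%:A) * (m + m - d%:A) =
          m * m + m * m + (m * m + m * m) - (m * d%:A + m * d%:A) -
          (d%:A * m + d%:A * m) + d%:A * d%:A by nc_ring.
      rewrite !mulr_algl mulr_algr scalerA -(expr2 d) -scalerA.
      have E4 a : 4 *: a = a + a + (a + a) :> A.
        by rewrite scaler_nat !mulrS mulr0n addr0 !addrA.
      by rewrite !E4; nc_ring.
    have -> : p * ((2 * (d * c))%:A - P) = (2 * (d * c)) *: p - m * m.
      by rewrite mulrBr mulr_algr pP.
    have -> : 4 *: ((2 * (d * c)) *: p - m * m) =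
        (8 * d * c) *: p - 4 *: (m * m).
      by rewrite scalerBr scalerA; congr (_ *: _ - _); ring.
    have -> : (8 * d * c) *: (c%:A - p) = (8 * d * c ^+ 2)%:A - (8 * d * c) *: p.
      by rewrite scalerBr scalerA expr2 (mulrA _ c c).
    by rewrite scalerDl; nc_ring.
  have c0 : 0 <= c by apply: le_trans c1.
  apply: PosD; [apply: PosD|]; apply: PosZ => //.
  - by rewrite !mulr_ge0 // ltW.
  - by apply: Pos_nrmB => //; rewrite /c; lra.
  - by rewrite mulr_ge0 // ltW.
have q_eta : nrm q <= eta.
  rewrite -(@ler_pXn2r _ 4) ?nnegrE ?nrm_ge0 ?(ltW eta0) //.
  rewrite nrm_sa_sqr // -exprM in q4; apply: le_trans q4 _.
  apply: le_trans d_eta; rewrite !expr2.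
  by nra.
have -> : h + eta%:A = p + (eta%:A - q) by rewrite /q; nc_ring.
by apply: PosD => //; exact: Pos_nrmB.
Qed.

(* For self-adjoint [h], [nrm h ^ 2 <= t] means that [t - h ^ 2] is a square,
   which any *-morphism preserves. *)
Lemma nrm_morphism_le (f : A -> A) : {morph f : a b / a + b} ->
  (forall r, {morph f : a / r *: a}) -> {morph f : a b / a * b} -> f 1 = 1 ->
  {morph f : a / star a} -> forall a, nrm (f a) <= nrm a.
Proof.
move=> fD fZ fM f1 fS.
have f_sa h : sa h -> nrm (f h) <= nrm h.
  move=> sah; rewrite -ler_sqr ?nnegrE ?nrm_ge0 //; apply: ler_gtP => d d0.
  have [||w [saw ww _ wC]] := @sqrt_BZ _ A (h * h) (nrm h ^+ 2 + d).
  - by rewrite /sa starM sah.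
  - by rewrite nrm_sa_sqr // ltrDl.
  apply: (@nrm_le_of_sum_sqr _ _ _ (f w)).
  - by rewrite /sa -fS sah.
  - by rewrite /sa -fS saw.
  - by rewrite /GRing.comm -!fM; congr (f _); apply: wC; apply: commrM.
  - by rewrite addr_ge0 ?sqr_ge0 // ltW.
  by rewrite -!fM -fD ww subrKC fZ f1.
move=> a; rewrite -ler_sqr ?nnegrE ?nrm_ge0 // -!nrm_star_mul -fS -fM f_sa //.
by rewrite /sa starM starK.
Qed.

End StarMul.

(** * Averages over the group and the invariant state *)

(** The topology of the group survives only in the last three fields, consequences of compactness
    and continuity. The elements [r%:A + s *: ii] are the complex multiples of 1. *)
Record ergodic_system (R : realType) (A : real_cstar R) := ErgodicSystem {
  grp :> choiceType;
  gmul : grp -> grp -> grp;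
  ginv : grp -> grp;
  gone : grp;
  gmulA : forall x y z, gmul (gmul x y) z = gmul x (gmul y z);
  gmul1 : forall x, gmul gone x = x;
  gmulV : forall x, gmul (ginv x) x = gone;
  gmulrV : forall x, gmul x (ginv x) = gone;
  act : grp -> A -> A;
  actD : forall x, {morph act x : a b / a + b};
  actZ : forall x r, {morph act x : a / r *: a};
  actM : forall x, {morph act x : a b / a * b};
  act1 : forall x, act x 1 = 1;
  act_star : forall x, {morph act x : a / star a};
  act_ii : forall x, act x (ii A) = ii A;
  act_gone : forall a, act gone a = a;
  act_gmul : forall x y a, act (gmul x y) a = act x (act y a);
  act_ergodic : forall a, (forall x, act x a = a) ->
    exists r s : R, a = r%:A + s *: ii A;
  len : grp -> R;
  len_bounded : exists2 c, 0 <= c & forall x, len x <= c;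
  len_act : forall a eta, 0 < eta ->
    exists2 eps, 0 < eps & forall x, len x <= eps -> nrm (act x a - a) <= eta;
  len_cover : forall eps, 0 < eps -> exists ys : seq grp, forall x,
    exists2 y, y \in ys & forall z,
      len (gmul (ginv (gmul y z)) (gmul x z)) <= eps
}.

Section Averages.
Variables (R : realType) (A : real_cstar R) (G : ergodic_system A).
Implicit Types (a b c h : A) (x y z : G) (s : seq G).

Local Notation star := (@star R A).
Local Notation nrm := (@nrm R A).
Local Notation ii := (ii A).
Local Notation al := (@act R A G).
Local Notation "x ** y" := (@gmul R A G x y) (at level 40).
Local Notation "x ^^-1" := (@ginv R A G x) (at level 3).

Lemma act0 x : al x 0 = 0.
Proof. by rewrite -(scale0r (0 : A)) actZ !scale0r. Qed.

Lemma actN x a : al x (- a) = - al x a.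
Proof. by rewrite -scaleN1r actZ scaleN1r. Qed.

Lemma actB x a b : al x (a - b) = al x a - al x b.
Proof. by rewrite actD actN. Qed.

Lemma act_alg x (r : R) : al x r%:A = r%:A.
Proof. by rewrite actZ act1. Qed.

Lemma act_sum x (I : Type) (s : seq I) (P : pred I) (F : I -> A) :
  al x (\sum_(i <- s | P i) F i) = \sum_(i <- s | P i) al x (F i).
Proof. by apply: (big_morph (al x)); [exact: actD|exact: act0]. Qed.

Lemma act_invK x a : al (x^^-1) (al x a) = a.
Proof. by rewrite -act_gmul gmulV act_gone. Qed.

Lemma nrm_act x a : nrm (al x a) = nrm a.
Proof.
have H y b : nrm (al y b) <= nrm b.
  apply: (@nrm_morphism_le _ _ (al y)); [exact: actD|exact: actZ|exact: actM|
    exact: act1|exact: act_star].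
by apply/le_anti; rewrite H -{1}(act_invK x a) H.
Qed.

Lemma gmulr1 x : x ** gone G = x.
Proof. by rewrite -(gmulV x) -gmulA gmulrV gmul1. Qed.

Lemma nrm_act_dist x y a : nrm (al x a - al y a) = nrm (al (y^^-1 ** x) a - a).
Proof. by rewrite -[RHS](nrm_act y) actB -act_gmul -gmulA gmulrV gmul1. Qed.

Lemma act_sa x a : sa a -> sa (al x a).
Proof. by move=> saa; rewrite /sa -act_star saa. Qed.

Lemma act_Pos x h : Pos h -> Pos (al x h).
Proof.
move=> [sah [t t0 ht]]; split; first exact: act_sa.
by exists t => //; rewrite -(act_alg x) -actB nrm_act.
Qed.

Definition avg s a := (size s)%:R^-1 *: \sum_(x <- s) al x a.

Lemma avgD s a b : avg s (a + b) = avg s a + avg s b.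
Proof.
rewrite /avg -scalerDr -big_split /=; congr (_ *: _).
by apply: eq_bigr => x _; rewrite actD.
Qed.

Lemma avgZ s (r : R) a : avg s (r *: a) = r *: avg s a.
Proof.
rewrite /avg scalerA mulrC -scalerA; congr (_ *: _).
by rewrite scaler_sumr; apply: eq_bigr => x _; rewrite actZ.
Qed.

Lemma avgB s a b : avg s (a - b) = avg s a - avg s b.
Proof. by rewrite avgD -scaleN1r avgZ scaleN1r. Qed.

Lemma avg_star s a : star (avg s a) = avg s (star a).
Proof.
by rewrite /avg starZ star_sum; congr (_ *: _); apply: eq_bigr => x _; rewrite act_star.
Qed.

Lemma avg_sa s a : sa a -> sa (avg s a).
Proof. by move=> saa; rewrite /sa avg_star saa. Qed.

Lemma avg_ii s a : avg s (ii * a) = ii * avg s a.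
Proof.
rewrite /avg -scalerAr mulr_sumr; congr (_ *: _).
by apply: eq_bigr => x _; rewrite actM act_ii.
Qed.

Lemma avg_Pos s h : Pos h -> Pos (avg s h).
Proof.
by move=> Ph; apply: PosZ; [rewrite invr_ge0|apply: Pos_sum => x _; exact: act_Pos].
Qed.

Lemma act_avg x s a : al x (avg s a) = avg [seq x ** y | y <- s] a.
Proof.
rewrite /avg actZ act_sum size_map big_map; congr (_ *: _).
by apply: eq_bigr => y _; rewrite act_gmul.
Qed.

Lemma avg_comp s t a : avg s (avg t a) = avg [seq x ** y | x <- s, y <- t] a.
Proof.
rewrite {1 3}/avg size_allpairs natrM invfM -scalerA; congr (_ *: _).
rewrite big_allpairs_dep /= scaler_sumr; apply: eq_bigr => x _.
by rewrite /avg actZ act_sum; congr (_ *: _); apply: eq_bigr => y _; rewrite act_gmul.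
Qed.

Lemma nrm_sum_le (s : seq G) (F : G -> A) d :
  (forall x, x \in s -> nrm (F x) <= d) ->
  nrm (\sum_(x <- s) F x) <= (size s)%:R * d.
Proof.
move=> H; apply: le_trans (nrm_sum _ _ _) _; rewrite big_seq.
apply: le_trans (ler_sum _ H) _.
by rewrite -big_seq big_const_seq count_predT iter_addr_0 mulr_natl.
Qed.

Lemma avg_sum_dist s a b d : s != [::] ->
  (forall x, x \in s -> nrm (al x a - b) <= d) -> nrm (avg s a - b) <= d.
Proof.
move=> s0 H; have n0 : (0 < (size s)%:R :> R) by rewrite ltr0n lt0n size_eq0.
have -> : avg s a - b = (size s)%:R^-1 *: \sum_(x <- s) (al x a - b).
  rewrite sumrB scalerBr big_const_seq count_predT iter_addr_0 -[b *+ _]scaler_nat.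
  by rewrite scalerA mulVf ?gt_eqF // scale1r.
rewrite nrmZ ger0_norm ?invr_ge0 ?ler0n // ler_pdivrMl //.
exact: nrm_sum_le.
Qed.

Lemma nrm_avg s a : nrm (avg s a) <= nrm a.
Proof.
have [->|s0] := eqVneq s [::]; first by rewrite /avg big_nil scaler0 nrm0 nrm_ge0.
rewrite -[avg s a]subr0; apply: avg_sum_dist => // x _.
by rewrite subr0 nrm_act.
Qed.

Lemma avg_alg s (r : R) : s != [::] -> avg s r%:A = r%:A.
Proof.
move=> s0; apply/eqP; rewrite -subr_eq0; apply/eqP/nrm_eq0/le_anti.
rewrite nrm_ge0 andbT; apply: avg_sum_dist => // x _.
by rewrite act_alg subrr nrm0.
Qed.

(* Quantifying over [z] makes closeness invariant under right translations,
   so that moduli of continuity survive averaging. *)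
Definition close eps x y := forall z, len ((y ** z)^^-1 ** (x ** z)) <= eps.

Definition equicont eps eta b :=
  forall x y, close eps x y -> nrm (al x b - al y b) <= eta.

Lemma closeM eps x y z : close eps x y -> close eps (x ** z) (y ** z).
Proof. by move=> xy w; rewrite !gmulA. Qed.

Lemma nrm_sum_pairing (s t : seq G) (F H : G -> A) d : size s = size t ->
  (forall x y, nrm (F x - H y) <= d) ->
  nrm (\sum_(x <- s) F x - \sum_(y <- t) H y) <= (size s)%:R * d.
Proof.
move=> st FH; elim: s t st => [|x s IH] [|y t] //=.
  by rewrite !big_nil subrr nrm0 mul0r.
case=> /IH h; rewrite !big_cons opprD addrACA -natr1 mulrDl mul1r addrC.
by apply: le_trans (nrmD _ _) (lerD _ _).
Qed.

Lemma equicont_avg eps eta s b : 0 <= eta ->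
  equicont eps eta b -> equicont eps eta (avg s b).
Proof.
move=> eta0 H x y xy.
rewrite /avg !actZ -scalerBr !act_sum -sumrB nrmZ ger0_norm ?invr_ge0 ?ler0n //.
have [->|s0] := eqVneq s [::]; first by rewrite big_nil nrm0 mulr0.
rewrite ler_pdivrMl ?ltr0n ?lt0n ?size_eq0 //.
apply: nrm_sum_le => z _; rewrite -!act_gmul; apply: H; exact: closeM.
Qed.

(* Some pair of terms of the two averages over [ys] can be matched within
   [eta]. *)
Lemma displ_avg eps eta d (ys : seq G) b :
  (forall x, exists2 y, y \in ys & close eps x y) ->
  equicont eps eta b -> (forall x, nrm (al x b - b) <= d) ->
  forall x, nrm (al x (avg ys b) - avg ys b) <=
            (1 - (size ys)%:R^-1) * d + (size ys)%:R^-1 * eta.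
Proof.
move=> cover eqb displ x.
have dist u v : nrm (al u b - al v b) <= d by rewrite nrm_act_dist.
case: ys cover => [|y0 ys] cover; first by have [] := cover x.
have [y1 y1s y1c] := cover (x ** y0).
rewrite /avg actZ act_sum -scalerBr nrmZ ger0_norm ?invr_ge0 ?ler0n //.
set m := size (y0 :: ys); have m0 : 0 < (m%:R : R) by rewrite ltr0n.
rewrite ler_pdivrMl // mulrDr mulrA mulrBr mulr1 divff ?gt_eqF // mulrA.
rewrite divff ?gt_eqF // mul1r.
rewrite [X in _ - X](big_rem y1) //= big_cons opprD addrACA -act_gmul addrC.
apply: le_trans (nrmD _ _) (lerD _ _); last exact: eqb.
have sz : size (rem y1 (y0 :: ys)) = size ys by rewrite size_rem.
have -> : m%:R - 1 = (size ys)%:R :> R by rewrite /m /= -natr1 addrK.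
apply: nrm_sum_pairing => [|u v]; first by rewrite -sz /=.
by rewrite -act_gmul.
Qed.

Lemma avg_iter (ys : seq G) n : ys != [::] -> exists2 T : seq G, T != [::] &
  forall a, avg T a = iter n (avg ys) a.
Proof.
move=> ys0; elim: n => [|n [T T0 IH]].
  exists [:: gone G] => // a.
  by rewrite /avg big_seq1 invr1 scale1r act_gone.
exists [seq x ** y | x <- ys, y <- T] => [|a].
  by rewrite -size_eq0 size_allpairs muln_eq0 !size_eq0 negb_or ys0 T0.
by rewrite -avg_comp IH.
Qed.

(** With [m] elements in the cover, one average scales the displacement by [r = 1 - m^-1] with error
    [(1 - r) * eta], so [n] of them give [r ^+ n * d + eta]. The family [T] depends on [eps] alone,
    which lets one sequence serve all elements. *)
Lemma halving eps : 0 < eps -> exists2 T : seq G, T != [::] &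
  forall b d eta, 0 <= eta -> equicont eps eta b ->
    (forall x, nrm (al x b - b) <= d) ->
    forall x, nrm (al x (avg T b) - avg T b) <= d / 2 + eta.
Proof.
move=> eps0; have [ys cover] := len_cover G eps0.
have ys0 : ys != [::].
  by apply/eqP => ys0; have [y] := cover (gone G); rewrite ys0.
set m : R := (size ys)%:R; have m0 : 0 < m by rewrite ltr0n lt0n size_eq0.
have m1 : 1 <= m by rewrite ler1n lt0n size_eq0.
pose r := 1 - m^-1.
have r0 : 0 <= r by rewrite subr_ge0 invf_le1.
have r1 : r < 1 by rewrite gtrBl invr_gt0.
have [n rn] : exists n, r ^+ n <= 2^-1.
  have /cvgrPdist_lt/(_ 2^-1) : (fun n => r ^+ n) @ \oo --> (0 : R).
    by apply: cvg_expr; rewrite ger0_norm.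
  rewrite invr_gt0 ltr0n => /(_ isT)[n _ /(_ n (leqnn n))] h.
  exists n; apply: ltW; apply: le_lt_trans h.
  by rewrite sub0r normrN ler_norm.
have [T T0 TE] := avg_iter n ys0; exists T => // b d eta eta0 eqb displ x.
have d0 : 0 <= d by apply: le_trans (displ (gone G)); exact: nrm_ge0.
rewrite TE; apply: (@le_trans _ _ (r ^+ n * d + eta)); last first.
  by rewrite lerD2r mulrC ler_wpM2l.
have : equicont eps eta (iter n (avg ys) b) /\
  forall x, nrm (al x (iter n (avg ys) b) - iter n (avg ys) b) <=
            r ^+ n * d + eta; last by case.
elim: (n) => [|k [IH1 IH2]] /=.
  by split=> // y; rewrite expr0 mul1r (le_trans (displ y)) // lerDl.
split; first exact: equicont_avg.
move=> y; apply: le_trans (displ_avg cover IH1 IH2 y) _.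
by rewrite -/r -/m exprS /r le_eqVlt; apply/orP; left; apply/eqP; ring.
Qed.

(* One sequence of averages serves all elements at once, so that the limit is
   linear. *)
Lemma mean_sequence : exists M : nat -> seq G,
  (forall k, M k != [::]) /\ forall a, exists2 c, nrm_lim (fun k => avg (M k) a) c &
    forall x, al x c = c.
Proof.
have /choice[T HT] (k : nat) : exists T : seq G, T != [::] /\
    forall b d eta, 0 <= eta -> equicont k.+1%:R^-1 eta b ->
    (forall x, nrm (al x b - b) <= d) ->
    forall x, nrm (al x (avg T b) - avg T b) <= d / 2 + eta.
  have k0 : 0 < k.+1%:R^-1 :> R by rewrite invr_gt0.
  by have [S S0 HS] := halving k0; exists S.
pose fix M k := if k is j.+1 then [seq x ** y | x <- T j, y <- M j]
                else [:: gone G].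
have M0 k : M k != [::].
  elim: k => //= k IH; rewrite -size_eq0 size_allpairs muln_eq0 !size_eq0.
  by rewrite negb_or IH (HT k).1.
exists M; split=> // a.
pose u k := avg (M k) a.
have uS k : u k.+1 = avg (T k) (u k) by rewrite /u avg_comp.
(* Averaging keeps the modulus [eps] of [a], so from stage [k0] on each [T k] halves the
   displacement with error [eta / 4]; the bound [d / 2 ^+ j + eta / 2] reproduces itself. *)
have small eta : 0 < eta -> exists K, forall x, nrm (al x (u K) - u K) <= eta.
  move=> eta0; have eta40 : 0 < eta / 4 by rewrite divr_gt0.
  have [eps eps0 Heps] := len_act G a eta40.
  have equ k : equicont eps (eta / 4) (u k).
    rewrite /u; apply: equicont_avg; first exact: ltW.
    move=> x y xy; rewrite nrm_act_dist; apply: Heps.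
    by have := xy (gone G); rewrite !gmulr1.
  pose k0 := Num.truncn eps^-1.
  have closek k x y : (k0 <= k)%N -> close k.+1%:R^-1 x y -> close eps x y.
    move=> kk xy z; apply: le_trans (xy z) _.
    rewrite invf_ple ?posrE //; apply/ltW/(lt_le_trans (truncnS_gt _)).
    by rewrite ler_nat.
  pose d := nrm a + nrm a.
  have dj j x : nrm (al x (u (k0 + j)%N) - u (k0 + j)%N) <=
      d / 2 ^+ j + eta / 2.
    elim: j x => [|j IH] x.
      rewrite addn0 expr0 divr1; apply: le_trans (nrmB _ _) _.
      rewrite nrm_act ler_wpDr ?divr_ge0 ?(ltW eta0) //.
      by rewrite lerD ?nrm_avg.
    rewrite addnS uS.
    apply: le_trans ((HT (k0 + j)%N).2 _ _ _ (ltW eta40) _ IH x) _.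
      by move=> y z yz; apply/equ/(closek (k0 + j)%N) => //; exact: leq_addr.
    rewrite exprS invfM; lra.
  pose j := Num.truncn (2 * d / eta).
  exists (k0 + j)%N => x; apply: le_trans (dj j x) _.
  suff : d / 2 ^+ j <= eta / 2 by lra.
  rewrite ler_pdivrMr ?exprn_gt0 //.
  have : 2 * d / eta < 2 ^+ j.
    apply: lt_le_trans (truncnS_gt _) _; rewrite -/j -natrX ler_nat.
    exact: ltn_expl.
  by rewrite ltr_pdivrMr //; lra.
(* Later terms are averages of translates of [u K], so they remain within [eta] of it; this yields
   the Cauchy property. *)
have stay eta K : (forall x, nrm (al x (u K) - u K) <= eta) ->
    forall j x, nrm (al x (u (K + j)%N) - u K) <= eta.
  move=> uK; elim=> [|j IH] x; first by rewrite addn0.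
  rewrite addnS uS act_avg; apply: avg_sum_dist => [|y /mapP[z _ ->]].
    by rewrite -size_eq0 size_map size_eq0 (HT _).1.
  by rewrite IH.
have stay1 eta K : (forall x, nrm (al x (u K) - u K) <= eta) ->
    forall j, nrm (u (K + j)%N - u K) <= eta.
  by move=> uK j; rewrite -[u (K + j)%N](@act_gone _ _ G); exact: stay.
have [c uc] : exists c, nrm_lim u c.
  apply: nrm_complete => eps eps0; have [K uK] := small _ (divr_gt0 eps0 (ltr0n R 2)).
  exists K => m n /subnKC <- /subnKC <-.
  apply: le_trans (nrm_dist3 _ (u K) _) _; rewrite [nrm (u K - _)]nrmBC.
  by rewrite (splitr eps) lerD ?stay1.
exists c => // x; apply/eqP; rewrite -subr_eq0; apply/eqP/nrm_eq0/le_anti.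
rewrite nrm_ge0 andbT; apply: ler_gtP => d d0; rewrite add0r.
have d40 : 0 < d / 4 by rewrite divr_gt0.
have [K uK] := small _ d40; have [N uN] := uc _ d40.
have {}uN := uN (K + N)%N (leq_addl _ _).
have uKN := stay _ _ uK N x; have uKN1 := stay1 _ _ uK N.
apply: le_trans (nrm_dist3 _ (al x (u (K + N)%N)) _) _.
rewrite -actB nrm_act (nrmBC c).
have := nrm_dist3 (al x (u (K + N)%N)) (u K) c.
have := nrm_dist3 (u K) (u (K + N)%N) c.
rewrite (nrmBC (u K) (u (K + N)%N)).
by move: uN uKN uKN1; lra.
Qed.

End Averages.

(** * The invariant state as a limit of averages *)

Section MeanState.
Variables (R : realType) (A : real_cstar R) (G : ergodic_system A).
Implicit Types (a b c h : A) (x y z : G) (s : seq G).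

Local Notation star := (@star R A).
Local Notation nrm := (@nrm R A).
Local Notation ii := (ii A).
Local Notation "x ** y" := (@gmul R A G x y) (at level 40).

(* [t] is the real part of the invariant state. *)
Record mean_state (t : A -> R) := MeanState {
  stateD : {morph t : a b / a + b};
  stateZ : forall r : R, {morph t : a / r *: a >-> r * a};
  state_le : forall a, `|t a| <= nrm a;
  state_Pos : forall h, Pos h -> 0 <= t h;
  state_sa : forall a, sa a -> t (ii * a) = 0;
  state_approx : forall (L : seq A) d, 0 < d -> exists2 s : seq G, s != [::] &
    forall a, a \in L -> nrm (avg s a - ((t a)%:A - t (ii * a) *: ii)) <= d
}.

Lemma nrm_limD (u v : nat -> A) a b :
  nrm_lim u a -> nrm_lim v b -> nrm_lim (fun k => u k + v k) (a + b).
Proof.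
move=> ua vb eps eps0; have e20 : 0 < eps / 2 by rewrite divr_gt0.
have [N1 h1] := ua _ e20; have [N2 h2] := vb _ e20.
exists (maxn N1 N2) => n; rewrite geq_max => /andP[/h1 {}h1 /h2 {}h2].
by rewrite opprD addrACA (le_trans (nrmD _ _)) // (splitr eps) lerD.
Qed.

Lemma nrm_lim_sa (u : nat -> A) a : nrm_lim u a -> (forall k, sa (u k)) -> sa a.
Proof.
move=> ua sau; apply: (limit_unique _ ua).
apply: (lim_lipschitz ler01 _ ua) => n.
by rewrite mul1r -{1}sau -starB nrm_star.
Qed.

Lemma nrm_lim_Pos (u : nat -> A) a :
  nrm_lim u a -> (forall k, Pos (u k)) -> Pos a.
Proof.
move=> ua Pu; have saa : sa a by apply: nrm_lim_sa ua _ => k; exact: (Pu k).1.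
apply: Pos_closed => // d /ua[N /(_ N (leqnn N)) h].
have -> : a + d%:A = u N + (d%:A - (u N - a)) by nc_ring.
by apply: PosD => //; apply: Pos_nrmB => //; rewrite /sa starB (Pu N).1 saa.
Qed.

Lemma nrm_ii : nrm ii = 1.
Proof.
have := nrm_star_mul ii; rewrite star_ii mulNr ii_sqr opprK nrm1.
by move=> /esym/eqP; rewrite sqrp_eq1 ?nrm_ge0 // => /eqP.
Qed.

Lemma alg_ii_inj (r s r' s' : R) :
  r%:A + s *: ii = r'%:A + s' *: ii -> r = r' /\ s = s'.
Proof.
move=> e; have e' := congr1 star e.
rewrite !starD !star_alg !starZ star_ii !scalerN in e'.
split.
  have : (2 * (r - r'))%:A = 0 :> A.
    have -> : (2 * (r - r'))%:A = (r%:A + s *: ii + (r%:A - s *: ii)) -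
       (r'%:A + s' *: ii + (r'%:A - s' *: ii)).
      by rewrite mulr_natl mulr2n scalerDl !scalerBl; nc_ring.
    by rewrite e e' subrr.
  move/(congr1 nrm); rewrite nrm_alg nrm0 => /eqP.
  by rewrite normr_eq0 mulf_eq0 pnatr_eq0 /= subr_eq0 => /eqP.
have : (2 * (s - s')) *: ii = 0.
  have -> : (2 * (s - s')) *: ii = (r%:A + s *: ii - (r%:A - s *: ii)) -
     (r'%:A + s' *: ii - (r'%:A - s' *: ii)).
    by rewrite mulr_natl mulr2n scalerDl !scalerBl; nc_ring.
  by rewrite e e' subrr.
move/(congr1 nrm); rewrite nrmZ nrm_ii mulr1 nrm0 => /eqP.
by rewrite normr_eq0 mulf_eq0 pnatr_eq0 /= subr_eq0 => /eqP.
Qed.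

(** [T a] records both coordinates of the scalar limit of the averages of [a]; uniqueness of limits
    turns the rules for averages into rules for [T]. *)
Lemma mean_state_exists : exists t, mean_state t.
Proof.
have [M [M0 MC]] := mean_sequence G.
have /choice[T HT] a : exists rs : R * R,
    nrm_lim (fun k => avg (M k) a) (rs.1%:A + rs.2 *: ii).
  have [c Mc fixc] := MC a; have [r [s cE]] := act_ergodic fixc.
  by exists (r, s); rewrite /= -cE.
have TE a (r s : R) : nrm_lim (fun k => avg (M k) a) (r%:A + s *: ii) ->
    T a = (r, s).
  move=> h; have [] := alg_ii_inj (limit_unique (HT a) h).
  by case: (T a) => /= ? ? -> ->.
have TD a b : T (a + b) = ((T a).1 + (T b).1, (T a).2 + (T b).2).
  apply: TE; rewrite !scalerDl addrACA => eps eps0.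
  have [N hN] := nrm_limD (HT a) (HT b) eps0.
  by exists N => n /hN; rewrite avgD.
have TZ (r : R) a : T (r *: a) = (r * (T a).1, r * (T a).2).
  apply: TE; rewrite -!scalerA -scalerDr.
  apply: lim_lipschitz (normr_ge0 r) _ (HT a) => n.
  by rewrite avgZ -scalerBr nrmZ.
(* Multiplication by [ii] rotates the coordinates, so the imaginary part of the state at [a] is
   [- t (ii * a)]. *)
have Tii a : T (ii * a) = (- (T a).2, (T a).1).
  apply: TE; apply: (lim_lipschitz ler01 _ (HT a)) => n.
  rewrite avg_ii mul1r -[leRHS]mul1r -nrm_ii.
  have -> : ii * avg (M n) a - ((- (T a).2)%:A + (T a).1 *: ii) =
            ii * (avg (M n) a - ((T a).1%:A + (T a).2 *: ii)).
    rewrite mulrBr mulrDr -!scalerAr mulr1 ii_sqr scaleNr scalerN.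
    by rewrite [- _ + _]addrC.
  exact: nrmM.
have Tsa a : sa a -> (T a).2 = 0.
  move=> saa; have : sa ((T a).1%:A + (T a).2 *: ii).
    by apply: nrm_lim_sa (HT a) _ => k; exact: avg_sa.
  rewrite /sa starD star_alg starZ star_ii scalerN -scaleNr => /alg_ii_inj[_].
  by lra.
exists (fun a => (T a).1); split.
- by move=> a b; rewrite TD.
- by move=> r a; rewrite TZ.
- move=> a; set r := (T a).1; set s := (T a).2.
  have : nrm (r%:A + s *: ii) <= nrm a.
    by apply: nrm_lim_le (HT a) _ => n; exact: nrm_avg.
  move=> h; have : nrm ((2 * r)%:A) <= 2 * nrm a.
    have -> : (2 * r)%:A = (r%:A + s *: ii) + star (r%:A + s *: ii).
      rewrite starD star_alg starZ star_ii scalerN mulr_natl mulr2n scalerDl.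
      nc_ring.
    by apply: le_trans (nrmD _ _) _; rewrite nrm_star; lra.
  by rewrite nrm_alg normrM ger0_norm // ler_pM2l.
- move=> h Ph; have : Pos ((T h).1%:A + (T h).2 *: ii).
    by apply: nrm_lim_Pos (HT h) _ => k; exact: avg_Pos.
  rewrite (Tsa _ Ph.1) scale0r addr0 => /Pos_ge H.
  by rewrite -oppr0; apply: H; rewrite subrr nrm0.
- by move=> a saa; rewrite Tii Tsa // oppr0.
move=> L d d0; suff [N HN] : exists N, forall n, (N <= n)%N -> forall a, a \in L ->
    nrm (avg (M n) a - ((T a).1%:A - (T (ii * a)).1 *: ii)) <= d.
  by exists (M N) => // a; exact: HN.
elim: L => [|a L [N HN]]; first by exists 0%N.
have [N' HN'] := HT a _ d0; exists (maxn N N') => n.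
rewrite geq_max => /andP[Nn N'n] b; rewrite inE => /predU1P[->|]; last exact: HN.
by rewrite Tii /= scaleNr opprK; exact: HN'.
Qed.

(** Double counting: every [x] in [s] contributes at least one pair with [y ** x] in [W]. *)
Lemma count_cover (W : pred G) (ys s : seq G) :
  (forall x, exists2 y, y \in ys & W (y ** x)) ->
  (size s <= count W [seq y ** x | y <- ys, x <- s])%N.
Proof.
move=> cover; rewrite -sum1_count big_mkcond big_allpairs_dep /= exchange_big /=.
rewrite -sum1_size; apply: leq_sum => x _; have [y yys Wy] := cover x.
by rewrite (big_rem y) //= Wy.
Qed.

(** Stands for a lower bound on the measure of [W]: translating by [ys] puts at least the fraction
    [(size ys)^-1] of the sample points in [W], while [avg ys] fixes scalars and does not increase
    norms, so the approximation is kept. *)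
Lemma good_average t (W : pred G) (ys : seq G) (L : seq A) d : mean_state t ->
  (forall x, exists2 y, y \in ys & W (y ** x)) -> 0 < d ->
  exists s, [/\ (0 < count W s)%N, (size s <= size ys * count W s)%N &
    forall a, a \in L -> nrm (avg s a - ((t a)%:A - t (ii * a) *: ii)) <= d].
Proof.
move=> tM cover d0; have [s s0 sL] := state_approx tM L d0.
have ys0 : ys != [::].
  by apply/eqP => ys0; have [y] := cover (gone G); rewrite ys0.
have cs := count_cover s cover.
exists [seq y ** x | y <- ys, x <- s]; split.
- by apply: leq_trans cs; rewrite lt0n size_eq0.
- by rewrite size_allpairs leq_mul2l cs orbT.
move=> a aL; rewrite -avg_comp.
have <- : avg ys ((t a)%:A - t (ii * a) *: ii) = (t a)%:A - t (ii * a) *: ii.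
  have av1 : avg ys 1 = 1 by have := @avg_alg _ _ G ys 1 ys0; rewrite scale1r.
  have avi : avg ys ii = ii by rewrite -{1}(mulr1 ii) avg_ii av1 mulr1.
  by rewrite avgB avg_alg // avgZ avi.
by rewrite -avgB (le_trans (nrm_avg _ _)) // sL.
Qed.

End MeanState.

(** * Bessel inequality and total boundedness *)

Section Bessel.
Variables (R : realType) (A : real_cstar R) (G : ergodic_system A).
Variable t : A -> R.
Hypothesis tM : mean_state G t.
Implicit Types (a b c h : A) (x y z : G) (s : seq G) (W : pred G).

Local Notation star := (@star R A).
Local Notation nrm := (@nrm R A).
Local Notation ii := (ii A).
Local Notation al := (@act R A G).
Local Notation "x ** y" := (@gmul R A G x y) (at level 40).

Lemma state0 : t 0 = 0.
Proof. by rewrite -(scale0r (0 : A)) (stateZ tM) mul0r. Qed.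

Lemma stateN a : t (- a) = - t a.
Proof. by rewrite -scaleN1r (stateZ tM) mulN1r. Qed.

Lemma stateB a b : t (a - b) = t a - t b.
Proof. by rewrite (stateD tM) stateN. Qed.

Lemma state_sum (I : Type) (s : seq I) (P : pred I) (F : I -> A) :
  t (\sum_(i <- s | P i) F i) = \sum_(i <- s | P i) t (F i).
Proof. by apply: (big_morph t); [exact: (stateD tM)|exact: state0]. Qed.

Lemma sum_act_filter W s a : (0 < count W s)%N ->
  \sum_(x <- s | W x) al x a =
  (count W s)%:R *: avg [seq x <- s | W x] a.
Proof.
move=> s0; rewrite /avg scalerA size_filter divff ?scale1r ?big_filter //.
by rewrite pnatr_eq0 -lt0n.
Qed.

Lemma avg_dist_filter W s a b d : (0 < count W s)%N ->
  (forall x, W x -> nrm (al x a - b) <= d) ->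
  nrm (avg [seq x <- s | W x] a - b) <= d.
Proof.
move=> s0 H; apply: avg_sum_dist.
  by rewrite -size_eq0 size_filter -lt0n.
by move=> x; rewrite mem_filter => /andP[Wx _]; exact: H.
Qed.

(** Cauchy-Schwarz as a variance identity: the difference is the sum of the squares of [al x a - g]
    over [W] and of those of [al x a] off [W]. *)
Lemma sum_sqr_filter W s a : sa a -> (0 < count W s)%N ->
  Pos (\sum_(x <- s) al x (a * a) - (count W s)%:R *:
       (avg [seq x <- s | W x] a * avg [seq x <- s | W x] a)).
Proof.
move=> saa s0; set g := avg _ a; set K : R := (count W s)%:R.
have sag : sa g by exact: avg_sa.
have -> : \sum_(x <- s) al x (a * a) - K *: (g * g) =
   \sum_(x <- s | W x) (al x a - g) * (al x a - g) +
   \sum_(x <- s | ~~ W x) al x (a * a).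
  rewrite (bigID W) /= addrAC; congr (_ + _).
  transitivity (\sum_(x <- s | W x) al x (a * a) - (K *: g) * g - g * (K *: g) +
                \sum_(x <- s | W x) g * g); last first.
    rewrite -sum_act_filter // mulr_suml mulr_sumr -!sumrB -big_split /=.
    by apply: eq_bigr => x _; rewrite actM; nc_ring.
  have -> : \sum_(x <- s | W x) g * g = K *: (g * g).
    by rewrite big_const_seq iter_addr_0 -[_ *+ count _ _]scaler_nat.
  by rewrite -(scalerAl K g g) -(scalerAr K g g) subrK.
apply: PosD; apply: Pos_sum => x _; first apply: Pos_sqr.
  by rewrite /sa starB -act_star saa sag.
by rewrite actM; apply/Pos_sqr/act_sa.
Qed.

Lemma state_sqr_ge W (ys : seq G) a eps :
  (forall x, exists2 y, y \in ys & W (y ** x)) -> sa a ->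
  (forall x, W x -> nrm (al x a - a) <= eps) -> eps <= nrm a ->
  (nrm a - eps) ^+ 2 <= (size ys)%:R * t (a * a).
Proof.
move=> cover saa Wa epsa; set m : R := (size ys)%:R.
have m0 : 0 <= m by exact: ler0n.
have m1 : 0 < m + 1 by rewrite ltr_wpDl.
have saaa : sa (a * a) by rewrite /sa starM saa.
have t0 : 0 <= t (a * a) by apply: (state_Pos tM); exact: Pos_sqr.
apply: ler_gtP => d d0; pose d' := d / (m + 1).
have d'0 : 0 < d' by rewrite divr_gt0.
have [s [s0 sm sL]] := good_average [:: a * a] tM cover d'0.
set K : R := (count W s)%:R; set M : R := (size s)%:R.
have K0 : 0 < K by rewrite ltr0n.
have M0 : 0 < M.
  by rewrite ltr0n (leq_trans s0) // count_size.
have MK : M <= m * K by rewrite /M /m /K -natrM ler_nat.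
set g := avg [seq x <- s | W x] a.
have ga : nrm (g - a) <= eps by exact: avg_dist_filter.
have ng : nrm a - eps <= nrm g.
  by have := nrmB g (g - a); rewrite subKr; lra.
have Pg : Pos ((M / K * (t (a * a) + d'))%:A - g * g).
  have -> : (M / K * (t (a * a) + d'))%:A - g * g = K^-1 *:
     (M *: ((t (a * a) + d')%:A - avg s (a * a)) +
      (\sum_(x <- s) al x (a * a) - K *: (g * g))).
    have -> : \sum_(x <- s) al x (a * a) = M *: avg s (a * a).
      by rewrite /avg scalerA divff ?gt_eqF // scale1r.
    rewrite scalerBr addrA subrK scalerBr !scalerA mulVf ?gt_eqF // scale1r.
    by rewrite [K^-1 * M]mulrC.
  apply: PosZ; first by rewrite invr_ge0 ltW.
  apply: PosD; last exact: sum_sqr_filter.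
  apply: PosZ; first exact: ltW.
  have := sL _ (mem_head _ _); rewrite (state_sa tM saaa) scale0r subr0 => h.
  have -> : (t (a * a) + d')%:A - avg s (a * a) =
            d'%:A - (avg s (a * a) - (t (a * a))%:A) by rewrite scalerDl; nc_ring.
  apply: Pos_nrmB => //; rewrite /sa starB star_alg.
  by rewrite avg_sa.
have := Pos_nrm_sqr (avg_sa _ saa : sa g) Pg => gle.
apply: (@le_trans _ _ (nrm g ^+ 2)).
  by rewrite ler_sqr ?nnegrE ?nrm_ge0 // subr_ge0.
apply: le_trans gle _; apply: (@le_trans _ _ (m * (t (a * a) + d'))).
  by rewrite ler_wpM2r ?addr_ge0 ?(ltW d'0) // ler_pdivrMr.
rewrite mulrDr lerD2l /d' mulrCA ger_pMr // ler_pdivrMr //.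
by rewrite mul1r lerDl.
Qed.

Lemma state_sandwich a e u v (c d : R) : nrm u <= c -> nrm v <= c ->
  nrm (e - a) <= d -> t (u * e * v) <= t (u * a * v) + c * c * d.
Proof.
move=> uc vc ead; have c0 : 0 <= c by apply: le_trans uc; exact: nrm_ge0.
rewrite -lerBlDl -stateB; apply: le_trans (ler_norm _) _.
apply: le_trans (state_le tM _) _.
have -> : u * e * v - u * a * v = u * (e - a) * v by nc_ring.
apply: le_trans (nrmM _ _) _.
rewrite (mulrAC c) ler_pM ?nrm_ge0 //.
apply: le_trans (nrmM _ _) _.
by rewrite ler_pM ?nrm_ge0.
Qed.

(* Sum over the average the squares of [1_W x - mu * \sum_i al x (d i) * g i]
   where [g i] averages [d i] over [W]. *)
Lemma bessel W (ys : seq G) (N : nat) (d : nat -> A) (c eps eta : R) :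
  (forall x, exists2 y, y \in ys & W (y ** x)) ->
  0 < c -> 0 < eta ->
  (forall i, (i < N)%N -> sa (d i)) ->
  (forall i, (i < N)%N -> nrm (d i) <= c) ->
  (forall i x, (i < N)%N -> W x -> nrm (al x (d i) - d i) <= eps) ->
  (forall i j, (i < N)%N -> (j < N)%N -> i != j ->
     `|t (d i * d j)| + `|t (ii * (d i * d j))| <= eta) ->
  \sum_(i < N) (t (d i * d i) - 2 * c * eps) <=
     c ^+ 2 * (size ys)%:R + N%:R ^+ 2 * (2 * eta).
Proof.
move=> cover c0 eta0 sad dc dW dd; set m : R := (size ys)%:R.
pose L := [seq d i * d j | i <- iota 0 N, j <- iota 0 N].
have [s [s0 sm sL]] := good_average L tM cover eta0.
set K : R := (count W s)%:R; set M : R := (size s)%:R.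
have K0 : 0 < K by rewrite ltr0n.
have M0 : 0 < M by rewrite ltr0n (leq_trans s0) // count_size.
have MK : M <= m * K by rewrite /M /m /K -natrM ler_nat.
pose g i := avg [seq x <- s | W x] (d i).
have sag (i : 'I_N) : sa (g i) by apply: avg_sa; exact: sad.
have gc (i : 'I_N) : nrm (g i) <= c by apply: le_trans (nrm_avg _ _) (dc _ _).
have gd (i : 'I_N) : nrm (g i - d i) <= eps.
  by apply: avg_dist_filter => // x; exact: dW.
pose S := \sum_(i < N) g i * g i.
have gS : \sum_(i < N) (t (d i * d i) - 2 * c * eps) <= t S.
  rewrite /S state_sum; apply: ler_sum => i _.
  rewrite lerBlDr -lerBlDl -stateB; apply: le_trans (ler_norm _) _.
  apply: le_trans (state_le tM _) _.
  have -> : d i * d i - g i * g i = - (g i * (g i - d i) + (g i - d i) * d i).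
    by nc_ring.
  rewrite nrmN; apply: le_trans (nrmD _ _) _.
  have -> : 2 * c * eps = c * eps + eps * c by ring.
  apply: lerD; apply: le_trans (nrmM _ _) _; rewrite ler_pM ?nrm_ge0 //.
  exact: dc.
apply: le_trans gS _.
pose E i j := avg s (d i * d j).
pose Q := \sum_(i < N) \sum_(j < N) t (g i * E i j * g j).
(* Diagonal averages are near the scalars [t (d i * d i) <= c ^+ 2], the others near scalars of size
   at most [eta]; another [eta] pays for replacing an average by its scalar, whence [2 * eta]. *)
have Qle : Q <= c ^+ 2 * (t S + N%:R ^+ 2 * (2 * eta)).
  have diag (i j : 'I_N) : t (g i * E i j * g j) <=
      (if i == j then c ^+ 2 * t (g i * g i) else 0) + c ^+ 2 * (2 * eta).
    have Eij : nrm (E i j - ((t (d i * d j))%:A - t (ii * (d i * d j)) *: ii)) <= eta.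
      apply: sL; apply/allpairsP; exists (i : nat, j : nat).
      by rewrite !mem_iota /= !ltn_ord.
    apply: le_trans (state_sandwich (gc i) (gc j) Eij) _.
    have -> : c ^+ 2 * (2 * eta) = c * c * eta + c * c * eta by ring.
    rewrite [leRHS]addrA lerD2r; have [<-|ij] := eqVneq i j.
      have saii : sa (d i * d i) by rewrite /sa starM sad.
      rewrite (state_sa tM saii) scale0r subr0 mulr_algr.
      rewrite -(scalerAl _ (g i) (g i)) (stateZ tM).
      apply: ler_wpDr; first by rewrite !mulr_ge0 // ltW.
      rewrite ler_wpM2r //.
        by apply/(state_Pos tM)/Pos_sqr.
      apply: le_trans (ler_norm _) _; apply: le_trans (state_le tM _) _.
      by rewrite expr2; apply: le_trans (nrmM _ _) _; rewrite ler_pM ?nrm_ge0 ?dc.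
    rewrite add0r; apply: le_trans (ler_norm _) _; apply: le_trans (state_le tM _) _.
    apply: le_trans (nrmM _ _) _; rewrite mulrAC ler_pM ?nrm_ge0 //.
    apply: le_trans (nrmM _ _) _; rewrite ler_pM ?nrm_ge0 //.
    apply: le_trans (nrmB _ _) _; rewrite nrm_alg nrmZ nrm_ii mulr1.
    by apply: dd => //; rewrite (inj_eq val_inj).
  rewrite /Q; apply: le_trans (ler_sum _ _) _.
    by move=> i _; apply: ler_sum => j _; exact: diag.
  have -> : \sum_(i < N) \sum_(j < N) ((if i == j then c ^+ 2 * t (g i * g i)
      else 0) + c ^+ 2 * (2 * eta)) =
      \sum_(i < N) (c ^+ 2 * t (g i * g i) + N%:R * (c ^+ 2 * (2 * eta))).
    apply: eq_bigr => i _; rewrite big_split /= -big_mkcond /=.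
    under eq_bigl => j do rewrite eq_sym.
    by rewrite big_pred1_eq sumr_const card_ord -[_ *+ N]mulr_natl.
  rewrite big_split /= -mulr_sumr -state_sum -/S sumr_const card_ord.
  by rewrite -[_ *+ N]mulr_natl le_eqVlt; apply/orP; left; apply/eqP; ring.
(* With this value [mu ^+ 2 * M * c ^+ 2 = mu * K]: the quadratic term cancels half of the cross
   term [2 * mu * K * t S], and a bound on [t S] remains. *)
pose mu := K / (M * c ^+ 2).
(* The translate stands left of its coefficient so that in [V x * U x] the factors [al x (d i)] and
   [al x (d j)] meet and average to [E i j]. *)
pose U x := \sum_(i < N) al x (d i) * g i.
pose V x := \sum_(i < N) g i * al x (d i).
have sU x : star (U x) = V x.
  rewrite /U star_sum; apply: eq_bigr => i _.
  by rewrite starM (sag i) -act_star sad.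
pose X x := (if W x then 1 else 0) - mu *: U x.
have XX x : star (X x) * X x =
    (if W x then 1 - mu *: (U x + V x) else 0) + mu ^+ 2 *: (V x * U x).
  rewrite /X starB starZ sU expr2 -scalerA; case: ifP => _.
    rewrite star1 scalerDr scalerAl scalerAr; nc_ring.
  by rewrite star0 !sub0r add0r mulrNN -scalerAl -scalerAr.
have SU : \sum_(x <- s | W x) U x = K *: S.
  rewrite exchange_big /= scaler_sumr; apply: eq_bigr => i _.
  by rewrite -mulr_suml sum_act_filter // -scalerAl.
have SV : \sum_(x <- s | W x) V x = K *: S.
  rewrite exchange_big /= scaler_sumr; apply: eq_bigr => i _.
  by rewrite -mulr_sumr sum_act_filter // -scalerAr.
have SVU : t (\sum_(x <- s) V x * U x) = M * Q.
  rewrite /Q mulr_sumr.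
  have -> : \sum_(x <- s) V x * U x =
      \sum_(i < N) \sum_(j < N) M *: (g i * E i j * g j).
    under eq_bigr => x _ do rewrite mulr_suml.
    rewrite exchange_big /=; apply: eq_bigr => i _.
    under eq_bigr => x _ do rewrite mulr_sumr.
    rewrite exchange_big /=; apply: eq_bigr => j _.
    have ME : M *: E i j = \sum_(x <- s) al x (d i * d j).
      by rewrite /E /avg scalerA divff ?gt_eqF // scale1r.
    rewrite (scalerAl M (g i * E i j)) (scalerAr M (g i)) ME.
    rewrite mulr_sumr mulr_suml; apply: eq_bigr => x _.
    by rewrite actM !mulrA.
  rewrite state_sum; apply: eq_bigr => i _; rewrite state_sum mulr_sumr.
  by apply: eq_bigr => j _; rewrite (stateZ tM).
have : 0 <= t (\sum_(x <- s) star (X x) * X x).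
  apply: (state_Pos tM); apply: Pos_sum => x _; exact: Pos_star_mul.
under eq_bigr => x _ do rewrite XX.
rewrite big_split /= -big_mkcond /= sumrB -!scaler_sumr big_split /= SU SV.
rewrite (stateD tM) stateB !(stateZ tM) (stateD tM) (stateZ tM) SVU.
have : t (\sum_(x <- s | W x) 1) <= K.
  apply: le_trans (ler_norm _) _; apply: le_trans (state_le tM _) _.
  by rewrite big_const_seq iter_addr_0 -[_ *+ count _ _]scaler_nat nrm_alg normr_nat.
move=> h1 h2; set B := N%:R ^+ 2 * (2 * eta) in Qle *.
have B0 : 0 <= B by rewrite mulr_ge0 ?sqr_ge0 // mulr_ge0 // ltW.
have c20 : 0 < c ^+ 2 by rewrite exprn_gt0.
have Mc : 0 < M * c ^+ 2 by rewrite mulr_gt0.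
have h3 : 0 <= K - mu * (K * t S + K * t S) + mu ^+ 2 * (M * Q) by lra.
have h4 : mu ^+ 2 * (M * Q) <= mu * (K * (t S + B)).
  have -> : mu * (K * (t S + B)) = mu ^+ 2 * (M * (c ^+ 2 * (t S + B))).
    rewrite /mu; field.
    by rewrite !gt_eqF.
  by rewrite ler_wpM2l ?sqr_ge0 // ler_wpM2l // ltW.
have h5 : mu * K * (t S - B) <= K.
  by rewrite mulrDr mulrN; move: h3 h4; rewrite !mulrDr !mulrA; lra.
have h6 : K * (t S - B) <= M * c ^+ 2.
  rewrite mulrAC -ler_pdivlMr // divff ?gt_eqF // in h5.
  by rewrite -[leRHS]mulr1 -ler_pdivrMl // mulrA [_ * K]mulrC.
rewrite -lerBlDr -(ler_pM2l K0); apply: le_trans h6 _.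
apply: le_trans (ler_wpM2r (ltW c20) MK) _.
by rewrite le_eqVlt; apply/orP; left; apply/eqP; ring.
Qed.

End Bessel.

(** Cut [[-c, c]] into cells of width [eta]; among more indices than patterns of cells, two share
    every cell. *)
Lemma pigeonhole_real (R : realType) (I : finType) (f : I -> nat -> R) (c eta : R) :
  0 < eta -> (forall i n, `|f i n| <= c) ->
  exists n m, n != m /\ forall i, `|f i n - f i m| <= eta.
Proof.
move=> eta0 fc.
pose cell (i : I) n := Num.truncn ((f i n + c) / eta).
have fc0 i n : 0 <= (f i n + c) / eta.
  by rewrite divr_ge0 ?(ltW eta0) //; have := fc i n; rewrite ler_norml; lra.
pose Q := Num.truncn (2 * c / eta).
have cellQ i n : (cell i n < Q.+1)%N.
  rewrite ltnS; apply: Num.Theory.le_truncn; rewrite ler_pM2r ?invr_gt0 //.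
  by have := fc i n; rewrite ler_norml; lra.
pose T : finType := {ffun I -> 'I_Q.+1}.
pose g (n : 'I_#|T|.+1) : T := [ffun i => inord (cell i n)].
have /injectivePn[n [m nm gnm]] : ~~ injectiveb g.
  apply/injectiveP => /leq_card.
  by rewrite card_ord ltnn.
exists (val n), (val m); split=> [|i]; first by rewrite (inj_eq val_inj).
have /(congr1 (@nat_of_ord _)) : g n i = g m i by rewrite gnm.
rewrite !ffunE !inordK // => cE.
have /andP[n1 n2] := Num.Theory.truncn_itv (fc0 i n).
have /andP[m1 m2] := Num.Theory.truncn_itv (fc0 i m).
rewrite -/(cell i n) cE in n1 n2; rewrite -/(cell i m) in m1 m2.
move: n1 n2 m1 m2; set k : R := (cell i m)%:R.
rewrite -natr1 -/k !ler_pdivlMr // !ltr_pdivrMr // ler_norml !mulrDl mul1r.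
by move=> *; apply/andP; split; lra.
Qed.

(** * Total boundedness of the Lipschitz ball modulo scalars *)

Section TotallyBounded.
Variables (R : realType) (A : real_cstar R) (G : ergodic_system A).
Implicit Types (a b : A) (x y z : G) (s : seq G) (r eps : R).

Local Notation star := (@star R A).
Local Notation nrm := (@nrm R A).
Local Notation ii := (ii A).
Local Notation al := (@act R A G).
Local Notation "x ** y" := (@gmul R A G x y) (at level 40).

(** [a - star a] is [ii] times a self-adjoint element, so [t] vanishes on it by [state_sa]. *)
Lemma state_star t a : mean_state G t -> t (star a) = t a.
Proof.
move=> tM; apply/eqP; rewrite eq_sym -subr_eq0 -(stateB tM).
have -> : a - star a = ii * (- (ii * (a - star a))).
  by rewrite mulrN mulrA ii_sqr mulN1r opprK.
rewrite (state_sa tM) // /sa starN starM star_ii starB starK mulrN opprK.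
by rewrite -ii_comm -mulrN opprB.
Qed.

(** Inductive step: the pigeonhole on the [2 * N] bounded sequences [t (d i * b n)] and
    [t (ii * (d i * b n))] finds a difference nearly orthogonal to all earlier [d i]. Products in
    the other order are adjoints, handled by [state_star]. *)
Lemma near_orthogonal_differences t (b : nat -> A) (c eta : R) (N : nat) :
  mean_state G t -> 0 < eta -> (forall n, sa (b n)) -> (forall n, nrm (b n) <= c) ->
  exists d : nat -> A,
    (forall i, (i < N)%N -> exists n m, n != m /\ d i = b n - b m) /\
    forall i j, (i < N)%N -> (j < N)%N -> i != j ->
      `|t (d i * d j)| + `|t (ii * (d i * d j))| <= eta.
Proof.
move=> tM eta0 sab bc; have c0 : 0 <= c by apply: le_trans (bc 0%N); exact: nrm_ge0.
elim: N => [|N [d [db dd]]]; first by exists (fun=> 0).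
have sad i : (i < N)%N -> sa (d i).
  by move=> /db[n [m [_ ->]]]; rewrite /sa starB !sab.
have dc i : (i < N)%N -> nrm (d i) <= c + c.
  by move=> /db[n [m [_ ->]]]; rewrite (le_trans (nrmB _ _)) // lerD.
pose f (p : 'I_N * bool) n :=
  if p.2 then t (d p.1 * b n) else t (ii * (d p.1 * b n)).
have e20 : 0 < eta / 2 by rewrite divr_gt0.
have [||n [m [nm fnm]]] := @pigeonhole_real R _ f ((c + c) * c) (eta / 2) => //.
  move=> [i e] n; have db_le : nrm (d i * b n) <= (c + c) * c.
    by apply: le_trans (nrmM _ _) _; rewrite ler_pM ?nrm_ge0 // dc.
  rewrite /f /=; case: e; apply: le_trans (state_le tM _) _ => //.
  by apply: le_trans (nrmM _ _) _; rewrite nrm_ii mul1r.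
pose v := b n - b m; have sav : sa v by rewrite /sa starB !sab.
have dv i : (i < N)%N -> `|t (d i * v)| + `|t (ii * (d i * v))| <= eta.
  move=> iN; rewrite !mulrBr !(stateB tM) (splitr eta).
  by apply: lerD; [exact: (fnm (Ordinal iN, true))|exact: (fnm (Ordinal iN, false))].
have vd i : (i < N)%N -> `|t (v * d i)| + `|t (ii * (v * d i))| <= eta.
  move=> iN; apply: le_trans (dv i iN).
  have vdE : v * d i = star (d i * v) by rewrite starM sad // sav.
  rewrite vdE (state_star _ tM) lerD2l.
  have -> : ii * star (d i * v) = - star (ii * (d i * v)).
    by rewrite [in RHS]starM star_ii mulrN opprK ii_comm.
  by rewrite (stateN tM) normrN (state_star _ tM).
exists (fun i => if (i < N)%N then d i else v); split.
  move=> i _; case: ifP => [/db //|_]; by exists n, m.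
move=> i j; rewrite !ltnS => iN jN ij.
case: ifPn => [iN'|Ni]; case: ifPn => [jN'|Nj]; first exact: dd.
- exact: dv.
- exact: vd.
move: ij; have -> : i = N by apply/eqP; rewrite eqn_leq iN leqNgt.
have -> : j = N by apply/eqP; rewrite eqn_leq jN leqNgt.
by rewrite eqxx.
Qed.

Lemma len_translate_cover eps : 0 < eps ->
  exists ys : seq G, forall x, exists2 y, y \in ys & len (y ** x) <= eps.
Proof.
move=> eps0; have [ys cover] := len_cover G eps0.
exists (map (@ginv _ _ G) ys) => x; have [y yys yx] := cover x.
exists (ginv y); first exact: map_f.
by have := yx (gone G); rewrite !gmulr1.
Qed.

(** The condition [L a <= 1] cleared of denominators, so that [x = e] needs no exception. *)
Definition lip_ball a := sa a /\ forall x, nrm (al x a - a) <= len x.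

(* [b n] are pairwise separated modulo scalars; the mean-zero representatives
   have a separated sequence of near-orthogonal differences, whose number is
   bounded by [bessel]. *)
Lemma no_separated_sequence eps (b : nat -> A) : 0 < eps ->
  (forall n, lip_ball (b n)) ->
  ~ (forall n m, n != m -> forall r, eps < nrm (b n - b m - r%:A)).
Proof.
move=> eps0 bL sep; have [t tM] := mean_state_exists G.
have [C0 C00 lenC] := len_bounded G.
pose c n := b n - (t (b n))%:A.
have sac n : sa (c n) by rewrite /sa starB star_alg (bL n).1.
(* Every translate of [b n], hence [avg s (b n)], lies within [C0] of [b n], and the average can be
   brought as close to the scalar [t (b n)] as desired. *)
have cC n : nrm (c n) <= C0.
  apply: ler_gtP => d d0.
  have [s s0 sL] := state_approx tM [:: b n] d0.
  have := sL _ (mem_head _ _); rewrite (state_sa tM (bL n).1) scale0r subr0 => h.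
  apply: le_trans (nrm_dist3 _ (avg s (b n)) _) _; apply: lerD => //.
  rewrite nrmBC; apply: avg_sum_dist => // x _.
  exact: le_trans ((bL n).2 x) (lenC x).
pose diff a := exists n m, n != m /\ a = c n - c m.
pose C := C0 + C0 + 1; have C_gt0 : 0 < C by rewrite /C; lra.
have diff_sa a : diff a -> sa a by move=> [n [m [_ ->]]]; rewrite /sa starB !sac.
have diff_C a : diff a -> nrm a <= C.
  move=> [n [m [_ ->]]]; apply: le_trans (nrmB _ _) _.
  by have := cC n; have := cC m; rewrite /C; lra.
have diff_lip a x : diff a -> nrm (al x a - a) <= 2 * len x.
  move=> [n [m [_ ->]]].
  have -> : al x (c n - c m) - (c n - c m) =
            (al x (b n) - b n) - (al x (b m) - b m).
    by rewrite /c !actB !act_alg; nc_ring.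
  apply: le_trans (nrmB _ _) _.
  by have := (bL n).2 x; have := (bL m).2 x; lra.
have diff_sep a : diff a -> eps <= nrm a.
  move=> [n [m [nm ->]]]; have := sep n m nm (t (b n) - t (b m)).
  rewrite scalerBl => /ltW h; apply: le_trans h _; rewrite le_eqVlt; apply/orP; left.
  by apply/eqP; congr nrm; rewrite /c; nc_ring.
have e40 : 0 < eps / 4 by rewrite divr_gt0.
have [ys1 cover1] := len_translate_cover e40.
set m1 : R := (size ys1)%:R.
have m1_gt0 : 0 < m1.
  rewrite ltr0n; case: (ys1) cover1 => // h; by have [y] := h (gone G).
(* Differences are 2-Lipschitz, so on [len x <= eps / 4] they move by at most [eps / 2], while their
   norm is at least [eps]; [state_sqr_ge] then gives [(eps / 2) ^+ 2 <= m1 * t (a * a)]. *)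
pose sigma := eps ^+ 2 / (4 * m1).
have sigma0 : 0 < sigma by rewrite divr_gt0 ?exprn_gt0 ?mulr_gt0.
have diff_t a : diff a -> sigma <= t (a * a).
  move=> da; have /= := state_sqr_ge tM (W := fun x => len x <= eps / 4) cover1
     (diff_sa _ da) (eps := eps / 2).
  have h1 x : len x <= eps / 4 -> nrm (al x a - a) <= eps / 2.
    by have := diff_lip _ x da; lra.
  have h2 := diff_sep _ da; move=> /(_ h1); rewrite -/m1.
  have h3 : eps / 2 <= nrm a by lra.
  move=> /(_ h3) h4; rewrite ler_pdivrMr ?mulr_gt0 // mulrC -mulrA.
  have : (eps / 2) ^+ 2 <= (nrm a - eps / 2) ^+ 2.
    by rewrite ler_sqr ?nnegrE; lra.
  by rewrite expr_div_n; lra.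
(* As [2 * C * e2 = sigma / 2], each summand in [bessel] is at least [sigma / 2]. The [eta] below
   makes the error term there equal to 1, and [N] makes [N * (sigma / 2)] exceed
   [C ^+ 2 * m2 + 1]. *)
pose e2 := sigma / (4 * C); have e20 : 0 < e2 by rewrite divr_gt0 // mulr_gt0.
have [ys2 cover2] := len_translate_cover (divr_gt0 e20 (ltr0n R 2)).
set m2 : R := (size ys2)%:R.
pose N := (Num.truncn ((C ^+ 2 * m2 + 1) / (sigma / 2))).+1.
have N_gt : (C ^+ 2 * m2 + 1) < N%:R * (sigma / 2).
  by rewrite -ltr_pdivrMr ?(divr_gt0 sigma0) //; exact: truncnS_gt.
have NN : 0 < (N%:R : R) ^+ 2 * 2 by rewrite mulr_gt0 // exprn_gt0.
pose eta := ((N%:R : R) ^+ 2 * 2)^-1; have eta0 : 0 < eta by rewrite invr_gt0.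
have [d [dc dd]] := near_orthogonal_differences N tM eta0 sac cC.
have := bessel tM (W := fun x => len x <= e2 / 2) (N := N) (d := d) (c := C)
  (eps := e2) cover2 C_gt0 eta0 (fun i iN => diff_sa _ (dc i iN))
  (fun i iN => diff_C _ (dc i iN)).
have dW i x : (i < N)%N -> len x <= e2 / 2 -> nrm (al x (d i) - d i) <= e2.
  by move=> iN xe; have := diff_lip _ x (dc i iN); lra.
move=> /(_ dW dd); rewrite mulrA mulfV ?gt_eqF // -/m2; apply/negP.
rewrite -ltNge; apply: lt_le_trans N_gt _.
have -> : N%:R * (sigma / 2) = \sum_(i < N) (sigma / 2).
  by rewrite sumr_const card_ord mulr_natl.
apply: ler_sum => i _; have := diff_t _ (dc i (ltn_ord i)).
have -> : 2 * C * e2 = sigma / 2 by rewrite /e2; field; rewrite gt_eqF.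
by lra.
Qed.

(** Greedy choice: if no finite family works, [hist] keeps adding an element separated from all
    earlier ones. The centres must lie in the ball itself so that states can be evaluated at
    them. *)
Lemma lip_ball_totally_bounded eps : 0 < eps -> exists F : seq A,
  (forall b, b \in F -> lip_ball b) /\
  forall a, lip_ball a -> exists2 b, b \in F & exists r, nrm (a - b - r%:A) <= eps.
Proof.
move=> eps0; apply: contrapT => H.
have /choice[f Hf] (F : seq A) : exists a, (forall b, b \in F -> lip_ball b) ->
    lip_ball a /\ forall b, b \in F -> forall r, eps < nrm (a - b - r%:A).
  have [FL|nFL] := pselect (forall b, b \in F -> lip_ball b); last by exists 0.
  apply: contrapT => nH; apply: H; exists F; split=> // a aL.
  apply: contrapT => nb; apply: nH; exists a => _; split=> // b bF r.
  by rewrite ltNge; apply/negP => h; apply: nb; exists b => //; exists r.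
pose fix hist n := if n is k.+1 then f (hist k) :: hist k else [::].
have histL n b : b \in hist n -> lip_ball b.
  elim: n b => //= n IH b; rewrite inE => /predU1P[->|/IH //].
  exact: (Hf _ IH).1.
have hist_mem n m : (n < m)%N -> f (hist n) \in hist m.
  elim: m => // m IH; rewrite ltnS leq_eqVlt => /predU1P[->|/IH h] /=.
    by rewrite mem_head.
  by rewrite inE h orbT.
apply: (@no_separated_sequence eps (fun n => f (hist n))) => // [n|n m nm r].
  exact: (Hf _ (histL n)).1.
have [nm'|mn] : (n < m)%N \/ (m < n)%N by apply/orP; rewrite -neq_ltn.
  have := (Hf _ (histL m)).2 _ (hist_mem _ _ nm') (- r).
  by rewrite -nrmN scaleNr; congr (_ < nrm _); nc_ring.
exact: (Hf _ (histL n)).2 _ (hist_mem _ _ mn) r.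
Qed.

End TotallyBounded.

(** * From compact groups and complex algebras to the real setting *)

Section CompactGroup.
Variables (R : realType) (G : topologicalType).
Variables (gmul : G -> G -> G) (ginv : G -> G) (e : G) (l : G -> R).
Hypothesis hG : compact_group gmul ginv e.
Hypothesis hl : length_function gmul ginv e l.

Lemma length_bounded : exists2 c, 0 <= c & forall x, l x <= c.
Proof.
case: hG => _ _ _ _ /compact_near_coveringP cG; case: hl => lc _ _ _ _.
have [] := cG _ \oo (fun n x => l x <= n%:R) _.
  move=> x _; pose k := Num.truncn (l x + 1).
  exists ([set y | l y < l x + 1], [set n | (k < n)%N]) => /=.
    split; last by exists k.+1.
    have /cvgrPdist_lt/(_ 1 ltr01) := lc x; apply: filterS => y.
    by rewrite /= ltr_norml; lra.
  move=> [y n] /= [ly kn]; apply/ltW/(lt_le_trans ly)/ltW.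
  by apply: lt_le_trans (truncnS_gt _) _; rewrite ler_nat.
move=> n _ /(_ n (leqnn n)) H; exists n%:R => // x; exact: H.
Qed.

(** By compactness [l] is bounded away from 0 off any neighbourhood of [e], so continuity at [e]
    becomes a modulus in terms of [l]. *)
Lemma length_small_near (P : set G) : nbhs e P ->
  exists2 eps, 0 < eps & forall x, l x <= eps -> P x.
Proof.
move=> Pe; case: hG => _ _ _ _ /compact_near_coveringP cG.
case: hl => lc l0 _ _ le0.
have [] := cG _ \oo (fun n x => l x <= n.+1%:R^-1 -> P x) _.
  move=> x _; have [->|xe] := pselect (x = e).
    exists (P, setT) => /=; first by split => //; exact: filterT.
    by move=> [y n] /= [].
  have lx : 0 < l x.
    by rewrite lt_neqAle l0 andbT; apply/eqP => /esym/le0.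
  pose k := Num.truncn (2 / l x).
  exists ([set y | l x / 2 < l y], [set n | (k <= n)%N]) => /=.
    split; last by exists k.
    have /cvgrPdist_lt/(_ (l x / 2)) := lc x.
    rewrite divr_gt0 // => /(_ isT); apply: filterS => y.
    by rewrite /= ltr_norml; lra.
  move=> [y n] /= [ly kn] lyn; exfalso; have := lt_le_trans ly lyn.
  apply/negP; rewrite -leNgt -[l x / 2]invrK lef_pV2 ?posrE ?invr_gt0 ?divr_gt0 //.
  rewrite invf_div; apply/ltW/(lt_le_trans (truncnS_gt _)).
  by rewrite ler_nat.
move=> n _ /(_ n (leqnn n)) H; exists n.+1%:R^-1; first by rewrite invr_gt0.
by move=> x; exact: H.
Qed.

(** Compactness acts twice: in [z], to make [U y] a neighbourhood of [y], and in [x], to extract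
    finitely many centres. *)
Lemma length_cover eps : 0 < eps -> exists ys : seq G, forall x,
  exists2 y, y \in ys & forall z, l (gmul (ginv (gmul y z)) (gmul x z)) <= eps.
Proof.
move=> eps0; case: hG => -[_ _ gV] mc ic _ cG; case: hl => lc _ _ _ le0.
have mulc (T : Type) (F : set_system T) (FF : Filter F) (f g : T -> G) a b :
    f @ F --> a -> g @ F --> b -> (fun x => gmul (f x) (g x)) @ F --> gmul a b.
  move=> fa gb. exact (@continuous2_cvg _ _ _ _ F FF f g gmul a b (mc (a, b)) fa gb).
pose U y := [set x | forall z, l (gmul (ginv (gmul y z)) (gmul x z)) <= eps].
have Uy y : nbhs y (U y).
  have /compact_near_coveringP nG := cG.
  have H z : [set: G] z -> \forall z' \near z & x \near nbhs y,
      l (gmul (ginv (gmul y z')) (gmul x z')) <= eps.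
    move=> _.
    have c1 : (@fst G G) @ filter_prod (nbhs z) (nbhs y) --> z by exact: cvg_fst.
    have c2 : (@snd G G) @ filter_prod (nbhs z) (nbhs y) --> y by exact: cvg_snd.
    have FF : Filter (filter_prod (nbhs z) (nbhs y)) by exact: filter_prod_filter.
    have c0 : (fun=> y : G) @ filter_prod (nbhs z) (nbhs y) --> y by exact: cvg_cst.
    have c3 := mulc _ _ FF _ _ _ _ c0 c1.
    have c4 := cvg_comp _ _ c3 (ic (gmul y z)).
    have c5 := mulc _ _ FF _ _ _ _ c4 (mulc _ _ FF _ _ _ _ c2 c1).
    have F := cvg_comp _ _ c5 (lc _).
    rewrite (gV _).1 (le0 e).2 // in F.
    have /cvgrPdist_le/(_ eps eps0) := F; apply: filterS => p.
    by rewrite /= sub0r normrN; apply: le_trans; exact: ler_norm.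
  have := nG _ (nbhs y)
    (fun x z => l (gmul (ginv (gmul y z)) (gmul x z)) <= eps) (nbhs_filter y) H.
  apply: filterS => x xy z; exact: xy.
(* Finite lists directed by inclusion: the near-covering form of compactness along this filter is
   the existence of a finite subcover. *)
pose F : set_system (seq G) :=
  [set P | exists s0 : seq G, forall s : seq G, {subset s0 <= s} -> P s].
have FF : Filter F.
  split; first by exists [::].
    move=> P Q [s1 H1] [s2 H2]; exists (s1 ++ s2) => s ss; split.
      by apply: H1 => x xs; apply: ss; rewrite mem_cat xs.
    by apply: H2 => x xs; apply: ss; rewrite mem_cat xs orbT.
  by move=> P Q PQ [s0 H]; exists s0 => s /H/PQ.
have /compact_near_coveringP nG := cG.
have H x : [set: G] x -> \forall x' \near x & s \near F,
    exists2 y, y \in s & U y x'.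
  move=> _; exists (U x, [set s : seq G | x \in s]) => /=.
    by split; [exact: Uy|exists [:: x] => s; apply; rewrite mem_head].
  by move=> [x' s] /= [Ux xs]; exists x.
have [ys Hys] := nG _ F (fun s x' => exists2 y, y \in s & U y x') FF H.
by exists ys => x; exact: (Hys ys).
Qed.

End CompactGroup.

(** * The complex algebra as an algebra over the reals *)

Section ComplexToReal.
Variables (R : realType) (A : completeNormedModType R[i])
  (mul : A -> A -> A) (one : A) (star : A -> A).
Hypothesis hA : cstar_algebra mul one star.

(** The proof argument is a phantom that makes the algebra laws available to the instances declared
    on the type. *)
Definition carrier of cstar_algebra mul one star : Type := A.
Local Notation B := (carrier hA).

HB.instance Definition _ := GRing.Zmodule.copy B A.

Definition rscale (r : R) (a : B) : B := (r%:C *: (a : A)).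

Fact rscaleA r s (a : B) : rscale r (rscale s a) = rscale (r * s) a.
Proof. by rewrite /rscale scalerA -rmorphM. Qed.
Fact rscale1 : left_id 1 rscale.
Proof. by move=> a; rewrite /rscale scale1r. Qed.
Fact rscaleDr : right_distributive rscale +%R.
Proof. by move=> r a b; rewrite /rscale -scalerDr. Qed.
Fact rscaleDl a : {morph rscale^~ a : r s / r + s}.
Proof. by move=> r s; rewrite /rscale -scalerDl -rmorphD. Qed.
HB.instance Definition _ :=
  GRing.Zmodule_isLmodule.Build R B rscaleA rscale1 rscaleDr rscaleDl.

Fact cmulA : associative (mul : B -> B -> B).
Proof. by move=> a b c; have [[h _ _ _] _ _ _ _] := hA; rewrite h. Qed.
Fact cmul1 : left_id (one : B) mul.
Proof. by move=> a; have [_ h _ _ _] := hA; case: (h a). Qed.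
Fact cmulr1 : right_id (one : B) mul.
Proof. by move=> a; have [_ h _ _ _] := hA; case: (h a). Qed.
Fact cmulDl : left_distributive (mul : B -> B -> B) +%R.
Proof. by move=> a b c; have [[_ h _ _] _ _ _ _] := hA; apply: h. Qed.
Fact cmulDr : right_distributive (mul : B -> B -> B) +%R.
Proof. by move=> a b c; have [[_ _ h _] _ _ _ _] := hA; apply: h. Qed.
Fact cone_neq0 : (one : B) != 0.
Proof. by have [_ _ h _ _] := hA; apply/eqP. Qed.
HB.instance Definition _ := GRing.Zmodule_isNzRing.Build B
  cmulA cmul1 cmulr1 cmulDl cmulDr cone_neq0.

Fact rscaleAl (r : R) (a b : B) : r *: (a * b) = (r *: a) * b.
Proof. by have [[_ _ _ h] _ _ _ _] := hA; case: (h r%:C a b). Qed.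
Fact rscaleAr (r : R) (a b : B) : r *: (a * b) = a * (r *: b).
Proof. by have [[_ _ _ h] _ _ _ _] := hA; case: (h r%:C a b). Qed.
HB.instance Definition _ := GRing.Lmodule_isLalgebra.Build R B rscaleAl.
HB.instance Definition _ := GRing.Lalgebra_isAlgebra.Build R B rscaleAr.

Definition rnrm (a : A) : R := complex.Re `|a|.

Lemma rnrmE a : `|a| = (rnrm a)%:C.
Proof. by rewrite RRe_real // ger0_real. Qed.

Lemma rnrm_complete (u : nat -> A) :
  (forall eps, 0 < eps ->
     exists N, forall m n, (N <= m)%N -> (N <= n)%N -> rnrm (u m - u n) <= eps) ->
  exists l, forall eps, 0 < eps ->
     exists N, forall n, (N <= n)%N -> rnrm (u n - l) <= eps.
Proof.
move=> uC.
have real_gt0 (eps : R[i]) : 0 < eps -> 0 < complex.Re eps /\ eps = (complex.Re eps)%:C.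
  move=> e0; have eE : eps = (complex.Re eps)%:C by rewrite RRe_real // gtr0_real.
  by split=> //; rewrite eE ltcR in e0.
have : cauchy (u @ \oo).
  apply/cauchy_ballP => eps /real_gt0[e0 ->].
  have [N HN] := uC _ (divr_gt0 e0 (ltr0n R 2)).
  exists ([set a | exists2 n, (N <= n)%N & a = u n],
          [set a | exists2 n, (N <= n)%N & a = u n]) => /=.
    by split; exists N => // n /= Nn; exists n.
  move=> [a b] /= [[m Nm ->] [n Nn ->]].
  rewrite -ball_normE /ball_ /= rnrmE ltcR; apply: le_lt_trans (HN _ _ Nm Nn) _.
  by rewrite gtr_pMr // invf_lt1 // ltr1n.
move=> /cauchy_cvg/cvg_ex[l /cvgrPdist_le ul]; exists l => eps eps0.
have : 0 < eps%:C by rewrite ltcR.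
move=> /ul[N _ HN]; exists N => n Nn.
by have := HN n Nn; rewrite /= rnrmE lecR -opprB /rnrm normrN.
Qed.

Fact rnrmZ (r : R) (a : B) : rnrm (r *: a) = `|r| * rnrm a.
Proof.
apply: complexI; rewrite rmorphM /= -!rnrmE.
apply: (etrans (normrZ r%:C (a : A))).
by rewrite (normc_def r%:C) /= expr0n /= addr0 sqrtr_sqr.
Qed.

Fact rstarZ (r : R) (a : B) : star (r *: a) = r *: (star a : B).
Proof.
have [_ _ _ [_ sZ _ _] _] := hA.
exact: etrans (sZ r%:C a) (congr1 (fun k => k *: star a) (conjc_real r)).
Qed.

Fact cstar1 : star one = one.
Proof.
have [_ m1 _ [_ _ sK sM] _] := hA.
by have := sM (star one) one; rewrite (m1 _).2 !sK (m1 _).2 => <-.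
Qed.

Definition ci : A := 'i%C *: one.

Fact mul_cil a : mul ci a = 'i%C *: a.
Proof.
have [[_ _ _ mZ] m1 _ _ _] := hA.
by rewrite /ci (mZ _ _ _).1 (m1 _).1.
Qed.

Fact mul_cir a : mul a ci = 'i%C *: a.
Proof.
have [[_ _ _ mZ] m1 _ _ _] := hA.
by rewrite /ci (mZ _ _ _).2 (m1 _).2.
Qed.

Fact ci_sqr : mul ci ci = - one.
Proof. by rewrite mul_cil /ci scalerA -expr2 sqr_i scaleN1r. Qed.

Fact star_ci : star ci = - ci.
Proof.
have [_ _ _ [_ sZ _ _] _] := hA.
rewrite /ci sZ cstar1 -scaleNr; congr (_ *: _).
by apply/eqP; rewrite eq_complex /= oppr0 !eqxx.
Qed.

Fact ci_comm a : mul ci a = mul a ci.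
Proof. by rewrite mul_cil mul_cir. Qed.

Fact rnrm_ge0 a : 0 <= rnrm a.
Proof. by rewrite -ler0c -rnrmE normr_ge0. Qed.

Fact rnrm_eq0 a : rnrm a = 0 -> a = 0.
Proof. by move=> a0; apply/eqP; rewrite -normr_eq0 rnrmE a0. Qed.

Fact rnrmD a b : rnrm (a + b) <= rnrm a + rnrm b.
Proof. by rewrite -lecR rmorphD /= -!rnrmE ler_normD. Qed.

Fact rnrmM a b : rnrm (mul a b) <= rnrm a * rnrm b.
Proof. by have [_ _ _ _ [nM _]] := hA; rewrite -lecR rmorphM /= -!rnrmE nM. Qed.

Fact rnrm_star_mul a : rnrm (mul (star a) a) = rnrm a ^+ 2.
Proof.
have [_ _ _ _ [_ nC]] := hA.
by apply: complexI; rewrite rmorphXn /= -!rnrmE nC.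
Qed.

Fact cstarD a b : star (a + b) = star a + star b.
Proof. by have [_ _ _ [h _ _ _] _] := hA. Qed.

Fact cstarK a : star (star a) = a.
Proof. by have [_ _ _ [_ _ h _] _] := hA. Qed.

Fact cstarM a b : star (mul a b) = mul (star b) (star a).
Proof. by have [_ _ _ [_ _ _ h] _] := hA. Qed.

Definition real_cstar_of : real_cstar R := @RealCstar R B star rnrm ci
  rnrm_ge0 rnrm_eq0 rnrmD rnrmZ rnrmM rnrm_star_mul rnrm_complete
  cstarD rstarZ cstarK cstarM ci_sqr star_ci ci_comm.

Variables (G : topologicalType) (gmul : G -> G -> G) (ginv : G -> G) (e : G).
Variables (alpha : G -> A -> A) (l : G -> R).
Hypothesis hG : compact_group gmul ginv e.
Hypothesis halpha : strongly_continuous_action mul one star gmul e alpha.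
Hypothesis herg : ergodic one alpha.
Hypothesis hl : length_function gmul ginv e l.

Let alphaP x : star_automorphism mul one star (alpha x).
Proof. by case: halpha. Qed.

Fact ract_ii x : alpha x ci = ci.
Proof. by have [_ h _ h1 _] := alphaP x; rewrite /ci h h1. Qed.

Fact ract_ergodic a : (forall x, alpha x a = a) ->
  exists r s : R, a = r%:C *: one + s%:C *: ci.
Proof.
move=> /herg[[r s] ->]; exists r, s; rewrite /ci scalerA -scalerDl.
by congr (_ *: _); rewrite {1}(complexE (r +i* s)%C) /= [_ * (s%:C)]mulrC.
Qed.

Fact length_action a eta : 0 < eta -> exists2 eps, 0 < eps &
  forall x, l x <= eps -> rnrm (alpha x a - a) <= eta.
Proof.
move=> eta0.
apply: (length_small_near hG hl (P := [set x | rnrm (alpha x a - a) <= eta])).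
have [_ a1 _ /(_ a e) ac] := halpha; have := ac.
move=> /cvgrPdist_le/(_ eta%:C); rewrite ltcR => /(_ eta0); apply: filterS => x.
by rewrite /= a1 rnrmE lecR /rnrm distrC.
Qed.

Fact cgmulA x y z : gmul (gmul x y) z = gmul x (gmul y z).
Proof. by have [[h _ _] _ _ _ _] := hG. Qed.

Fact cgmul1 x : gmul e x = x.
Proof. by have [[_ h _] _ _ _ _] := hG; case: (h x). Qed.

Fact cgmulV x : gmul (ginv x) x = e.
Proof. by have [[_ _ h] _ _ _ _] := hG; case: (h x). Qed.

Fact cgmulrV x : gmul x (ginv x) = e.
Proof. by have [[_ _ h] _ _ _ _] := hG; case: (h x). Qed.

Fact ractD x : {morph alpha x : a b / a + b}.
Proof. by have [h _ _ _ _] := alphaP x. Qed.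

Fact ractZ x (r : R) : {morph alpha x : a / (r *: (a : B) : A)}.
Proof. by have [_ h _ _ _] := alphaP x; exact: h. Qed.

Fact ractM x : {morph alpha x : a b / mul a b}.
Proof. by have [_ _ h _ _] := alphaP x. Qed.

Fact ract1 x : alpha x one = one.
Proof. by have [_ _ _ h _] := alphaP x. Qed.

Fact ract_star x : {morph alpha x : a / star a}.
Proof. by have [_ _ _ _ [h _]] := alphaP x. Qed.

Fact ract_gone a : alpha e a = a.
Proof. by have [_ h _ _] := halpha. Qed.

Fact ract_gmul x y a : alpha (gmul x y) a = alpha x (alpha y a).
Proof. by have [_ _ h _] := halpha. Qed.

Definition ergodic_system_of : ergodic_system real_cstar_of :=
  @ErgodicSystem R real_cstar_of G gmul ginv e cgmulA cgmul1 cgmulV cgmulrV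
    alpha ractD ractZ ractM ract1 ract_star ract_ii ract_gone ract_gmul
    ract_ergodic l (length_bounded hG hl) length_action (length_cover hG hl).

Lemma lip_ball_ofP a :
  @lip_ball _ _ ergodic_system_of a <->
  star a = a /\ forall x, rnrm (alpha x a - a) <= l x.
Proof. by []. Qed.

End ComplexToReal.

(** * The Lip-norm *)

Section LipNorm.
Variables (R : realType) (A : completeNormedModType R[i])
  (mul : A -> A -> A) (one : A) (star : A -> A).
Variables (G : topologicalType) (gmul : G -> G -> G) (ginv : G -> G) (e : G).
Variables (alpha : G -> A -> A) (l : G -> R).
Hypothesis hA : cstar_algebra mul one star.
Hypothesis hG : compact_group gmul ginv e.
Hypothesis halpha : strongly_continuous_action mul one star gmul e alpha.
Hypothesis herg : ergodic one alpha.
Hypothesis hl : length_function gmul ginv e l.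

Local Notation L := (Lip_seminorm e alpha l).
Local Notation V := [set a | star a = a /\ (L a < +oo)%E].
Local Notation S := (state_space mul one star V).
Local Notation E := (ergodic_system_of hA hG halpha herg hl).
Implicit Types (a b : A) (x : G) (r c : R).

Lemma length_gt0 x : x <> e -> 0 < l x.
Proof.
case: hl => _ l0 _ _ le0 xe.
by rewrite lt_neqAle l0 andbT; apply/eqP => /esym/le0.
Qed.

Lemma Lip_ge0 a : (0 <= L a)%E.
Proof. by apply: ereal_sup_ubound; left. Qed.

Lemma Lip_leP a c : 0 <= c ->
  (L a <= c%:E)%E <-> forall x, rnrm (alpha x a - a) <= c * l x.
Proof.
move=> c0; split=> [La x|H].
  have [->|xe] := pselect (x = e).
    have [_ ae _ _] := halpha; have [_ _ _ _ /(_ e)[_ le0]] := hl.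
    by rewrite ae subrr /rnrm normr0 le0 // mulr0.
  rewrite -ler_pdivrMr ?length_gt0 // -lee_fin; apply: le_trans La.
  by apply: ereal_sup_ubound; right; exists x.
apply: ge_ereal_sup => _ [->|[x xe <-]]; first by rewrite lee_fin.
by rewrite lee_fin ler_pdivrMr ?length_gt0 //; exact: H.
Qed.

Lemma Lip_lt_pinfty a : (L a < +oo)%E -> exists2 c, 0 <= c & L a = c%:E.
Proof.
by have := Lip_ge0 a; case: (L a) => [c| |] // c0 _; exists c.
Qed.

Lemma LipD a b : V a -> V b -> (L (a + b)%R <= L a + L b)%E.
Proof.
move=> [_ /Lip_lt_pinfty[c c0 aE]] [_ /Lip_lt_pinfty[d d0 bE]].
rewrite aE bE -EFinD; apply/Lip_leP; first exact: addr_ge0.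
move=> x; rewrite (ractD halpha) opprD addrACA; apply: le_trans (rnrmD _ _) _.
rewrite mulrDl lerD //; [move: x|move: x]; apply/Lip_leP => //.
  by rewrite aE.
by rewrite bE.
Qed.

Lemma rnrm_scale r a : rnrm (r%:C *: a) = `|r| * rnrm a.
Proof. exact: (@rnrmZ _ _ _ _ _ hA). Qed.

Lemma LipZ_le r a c : 0 <= c -> (L a <= c%:E)%E -> (L (r%:C *: a) <= (`|r| * c)%:E)%E.
Proof.
move=> c0 /Lip_leP-/(_ c0) La; apply/Lip_leP; first by rewrite mulr_ge0.
move=> x; rewrite (ractZ hA halpha) -[_ - _]/(r%:C *: alpha x a - r%:C *: a).
rewrite -scalerBr rnrm_scale -mulrA; exact: ler_wpM2l.
Qed.

Lemma LipZ r a : V a -> L (r%:C *: a) = (`|r|%:E * L a)%E.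
Proof.
move=> [_ /Lip_lt_pinfty[c c0 aE]]; rewrite aE -EFinM; apply/le_anti.
rewrite LipZ_le ?aE //=; have [->|r0] := eqVneq r 0.
  by rewrite normr0 mul0r Lip_ge0.
have : (L (r%:C *: a) < +oo)%E.
  by apply: le_lt_trans (LipZ_le r c0 _) (ltry _); rewrite aE.
move=> /Lip_lt_pinfty[d d0 raE]; rewrite raE lee_fin.
have : (L (r^-1%:C *: (r%:C *: a)) <= (`|r^-1| * d)%:E)%E.
  by apply: LipZ_le; rewrite ?raE.
rewrite scalerA -rmorphM /= mulVf // scale1r aE lee_fin normfV.
by rewrite ler_pdivlMl ?normr_gt0.
Qed.

Lemma V_D a b : V a -> V b -> V (a + b).
Proof.
move=> Va Vb; split; first by rewrite (cstarD hA) Va.1 Vb.1.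
by apply: le_lt_trans (LipD Va Vb) _; rewrite lte_add_pinfty // ?Va.2 ?Vb.2.
Qed.

Lemma V_Z r a : V a -> V (r%:C *: a).
Proof.
move=> Va; split; first by rewrite [LHS](@rstarZ _ _ _ _ _ hA r a) Va.1.
rewrite LipZ //; have [c c0 ->] := Lip_lt_pinfty Va.2.
by rewrite -EFinM ltry.
Qed.

Lemma Lip_one : L one = 0%E.
Proof.
apply/le_anti; rewrite Lip_ge0 andbT; apply/Lip_leP => // x.
by rewrite (ract1 halpha) subrr /rnrm normr0 mul0r.
Qed.

Lemma V_one : V one.
Proof. by split; [exact: cstar1 hA|rewrite Lip_one ltry]. Qed.

(** [rnrm b + d - b] is the square of a self-adjoint [w], hence positive in [A]; membership in [V]
    is asked only of the combination of [one] and [b], not of [w]. *)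
Lemma state_le_nrm (mu : A -> R) a : S mu -> V a -> `|mu a| <= rnrm a.
Proof.
move=> [muD muZ muP mu1] Va.
have mu_le b : V b -> mu b <= rnrm b.
  move=> Vb; apply: ler_gtP => d d0.
  have [||w [saw ww _ _]] := @sqrt_BZ _ (real_cstar_of hA) b (rnrm b + d).
  - exact: Vb.1.
  - by rewrite ltrDl.
  pose T := rnrm b + d.
  have V1 : V (T%:C *: one) by apply: V_Z; exact: V_one.
  have V2 : V ((-1)%:C *: b) by exact: V_Z.
  have : 0 <= mu (T%:C *: one + (-1)%:C *: b).
    apply: muP; first exact: V_D.
    exists w; rewrite rmorphN1 scaleN1r.
    by rewrite [star w]saw; exact: esym ww.
  by rewrite muD // (muZ _ _ V_one) (muZ _ _ Vb) mu1 /T; lra.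
rewrite ler_norml mu_le // andbT lerNl.
have := mu_le _ (V_Z (-1) Va); rewrite muZ // mulN1r rnrm_scale.
by rewrite normrN1 mul1r.
Qed.

Lemma V_lip_ball a : V a /\ (L a <= 1%:E)%E <-> @lip_ball _ _ E a.
Proof.
rewrite lip_ball_ofP; split=> [[[sa _] /Lip_leP-/(_ ler01) La]|[sa La]].
  by split=> // x; rewrite -[l x]mul1r; exact: La.
have L1 : (L a <= 1%:E)%E by apply/Lip_leP => // x; rewrite mul1r; exact: La.
by split=> //; split=> //; apply: le_lt_trans L1 (ltry _).
Qed.

(** Finitely many centres [b] cover the ball modulo scalars. Two states agree on scalars, differ by
    less than [eps / 8] at [b], and are each at most [eps / 8] in absolute value at the remainder
    [d]: less than [eps / 2] in all. *)
Lemma rhoL_weakstar (U : set (A -> R)) :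
  rhoL_open V L S U -> weakstar_open V S U.
Proof.
move=> [US Uopen]; split=> // mu Umu; have Smu := US _ Umu.
have [eps eps0 Ueps] := Uopen _ Umu.
have e80 : 0 < eps / 8 by rewrite divr_gt0.
have [F [FL Fcov]] := @lip_ball_totally_bounded _ _ E _ e80.
exists [set` F], (eps / 8); split=> //; first exact: finite_seq.
  by move=> b /= /FL /V_lip_ball[].
move=> nu Snu nuF; apply: Ueps => //.
apply: (@le_lt_trans _ _ (eps / 2)%:E); last by rewrite lte_fin; lra.
apply: ge_ereal_sup => _ [a [Va La] <-]; rewrite lee_fin.
have [/= b bF [r ab]] := Fcov a ((V_lip_ball a).1 (conj Va La)).
have Vb : V b by have [] := (V_lip_ball b).2 (FL b bF).
pose d : A := a - (b : A) - r%:C *: one.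
have Vr : V (r%:C *: one) by apply: V_Z; exact: V_one.
have VN a' : V a' -> V (- a').
  by move=> Va'; rewrite -scaleN1r -(rmorphN1 (real_complex R)); exact: V_Z.
have Vd : V d by apply: V_D; [apply: V_D => //; exact: VN|exact: VN].
have dE : a = d + ((b : A) + r%:C *: one) by rewrite /d addrCA subrK addrC subrK.
have st f : S f -> f a = f d + (f b + r).
  move=> [fD fZ _ f1]; rewrite {1}dE fD //; last exact: V_D.
  by rewrite fD // fZ ?f1 ?mulr1 //; exact: V_one.
have mud := state_le_nrm Smu Vd; have nud := state_le_nrm Snu Vd.
have dle : rnrm d <= eps / 8 := ab.
rewrite (st _ Smu) (st _ Snu).
have := nuF b bF; move: mud nud dle; rewrite !ler_norml ltr_norml => *.
by apply/andP; split; lra.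
Qed.

(** A finite [F] has a common Lipschitz bound [c], and dividing by [c] brings its elements into the
    unit ball of [L], where [rhoL] controls the states. *)
Lemma weakstar_rhoL (U : set (A -> R)) :
  weakstar_open V S U -> rhoL_open V L S U.
Proof.
move=> [US Uopen]; split=> // mu Umu; have Smu := US _ Umu.
have [F [eps [/finite_seqP[s sE] FV eps0 Ueps]]] := Uopen _ Umu.
have [c c0 Lc] : exists2 c : R, 0 < c & forall a, a \in s -> (L a <= c%:E)%E.
  have : forall a, a \in s -> V a by move=> a a_s; apply: FV; rewrite sE.
  elim: (s) => [_|a s' IH sV]; first by exists 1.
  have [|c c0 Hc] := IH; first by move=> b bs; apply: sV; rewrite inE bs orbT.
  have [d d0 dE] := Lip_lt_pinfty (sV a (mem_head _ _)).2.
  exists (c + d) => [|b]; first by rewrite ltr_wpDr.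
  rewrite inE => /predU1P[->|/Hc h].
    by rewrite dE lee_fin lerDr ltW.
  by apply: le_trans h _; rewrite lee_fin lerDl.
exists (eps / c) => [|nu Snu munu]; first by rewrite divr_gt0.
apply: Ueps => // a; rewrite sE /= => a_s.
have Va : V a by apply: FV; rewrite sE.
have Vca : V (c^-1%:C *: a) by exact: V_Z.
have : (L (c^-1%:C *: a) <= 1%:E)%E.
  apply: le_trans (LipZ_le _ (ltW c0) (Lc _ a_s)) _.
  by rewrite ger0_norm ?invr_ge0 ?(ltW c0) // mulVf // gt_eqF.
move=> Lca; have : (`|mu (c^-1%:C *: a) - nu (c^-1%:C *: a)|%:E < (eps / c)%:E)%E.
  apply: le_lt_trans munu; apply: ereal_sup_ubound.
  by exists (c^-1%:C *: a).
rewrite lte_fin; have [_ muZ _ _] := Smu; have [_ nuZ _ _] := Snu.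
rewrite muZ // nuZ // -mulrBr normrM ger0_norm ?invr_ge0 ?(ltW c0) //.
by rewrite mulrC ltr_pM2r ?invr_gt0 // distrC.
Qed.

End LipNorm.

Theorem theorem2p2 (R : realType) (A : completeNormedModType R[i])
  (mul : A -> A -> A) (one : A) (star : A -> A)
  (G : topologicalType) (gmul : G -> G -> G) (ginv : G -> G) (e : G)
  (alpha : G -> A -> A) (l : G -> R) :
  cstar_algebra mul one star ->
  compact_group gmul ginv e ->
  strongly_continuous_action mul one star gmul e alpha ->
  ergodic one alpha ->
  length_function gmul ginv e l ->
  is_Lip_norm mul one star
    [set a | star a = a /\ (Lip_seminorm e alpha l a < +oo)%E]
    (Lip_seminorm e alpha l).
Proof.
move=> hA hG halpha herg hl; split.
- by move=> a [].
- exact: (V_one hA halpha hl).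
- by move=> a b Va Vb; exact: (V_D hA halpha hl Va Vb).
- by move=> r a Va; exact: (V_Z hA halpha hl r Va).
split.
- by move=> a [_ /Lip_lt_pinfty[c _ ->]]; exists c.
- by move=> a b Va Vb; exact: (LipD halpha hl Va Vb).
- by move=> r a Va; exact: (LipZ hA halpha hl r Va).
- exact: (Lip_one halpha hl).
move=> U _; split; first exact: (rhoL_weakstar hA hG halpha herg hl).
exact: (weakstar_rhoL hA halpha hl).
Qed.
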